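(* Let $m\ge 1$ and let $\{(N_j, B_j, L_j): 1 \le j \le m\}$ be finitely many Hadamard triples in $\mathbb{R}$. Suppose that $\gcd(B_j - B_j) = 1$ for $1\le j \le m$. For $\omega=(\omega_k)_{k=1}^\infty \in \Omega = \{1,2,\dots,m\}^{\mathbb{N}}$ let $$\mu_\omega = \delta_{N_{\omega_1}^{-1} B_{\omega_1}} * \delta_{(N_{\omega_1} N_{\omega_2})^{-1} B_{\omega_2}} * \cdots * \delta_{(N_{\omega_1} N_{\omega_2}\cdots N_{\omega_k})^{-1} B_{\omega_k} }* \cdots.$$ Then $\mu_\omega$ is a spectral measure for every $\omega \in \Omega$.
   Context: A Hadamard triple in $\mathbb{R}$ is a triple $(N,B,L)$ where $N\in\mathbb{Z}$ with $|N|\ge 2$, and $B,L\subseteq\mathbb{Z}$ are finite sets with $\#B=\#L\ge 2$ such that the matrix $\left[\frac{1}{\sqrt{\#B}}\, e^{-2\pi i b\ell/N}\right]_{b\in B,\ \ell\in L}$ is unitary. For a finite set $B\subseteq\mathbb{Z}$, $B-B=\{b-b': b,b'\in B\}$, and $\gcd(B-B)$ is the greatest common divisor of the elements of this set. For a finite nonempty set $A\subseteq\mathbb{R}$, $\delta_A=\frac{1}{\#A}\sum_{a\in A}\delta_a$, where $\delta_a$ is the Dirac measure at $a$; for a real number $c$, $cA=\{ca:a\in A\}$. An infinite convolution denotes the weak limit of the finite partial convolutions (in the present setting this weak limit exists and is a Borel probability measure with compact support). A Borel probability measure $\mu$ on $\mathbb{R}$ is a spectral measure if there is a countable set $\Lambda\subseteq\mathbb{R}$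 such that the family of exponentials $\{e_\lambda(x)=e^{2\pi i\lambda x}:\lambda\in\Lambda\}$ forms an orthonormal basis of $L^2(\mu)$. *)

(* Defs.v *)
From HB Require Import structures.
From mathcomp Require Import all_boot all_order all_algebra.
From mathcomp Require Import spectral finmap.
From mathcomp Require Import complex.
From mathcomp Require Import all_classical all_reals all_analysis.

Set Implicit Arguments.
Unset Strict Implicit.
Unset Printing Implicit Defensive.

Import Order.TTheory GRing.Theory Num.Theory.
Import numFieldNormedType.Exports.

Local Open Scope classical_set_scope.
Local Open Scope ring_scope.
Local Open Scope complex_scope.

(* e^{it} for real t *)
Definition expi {R : realType} (t : R) : R[i] := cos t +i* sin t.

(* Rows and columns follow the duplicate-free enumerations of B and L; unitarity
   does not depend on the order. *)
Definition hadamard_mx (R : realType) (N : int) (B L : {fset int}) :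
    'M[R[i]]_(#|` B|, #|` L|) :=
  \matrix_(i < #|` B|, j < #|` L|)
    (((Num.sqrt #|` B|%:R)^-1)%:C *
     expi (- (2 * pi * (nth 0 B i)%:~R * (nth 0 L j)%:~R / N%:~R))).

Definition hadamard_triple (R : realType) (N : int) (B L : {fset int}) : Prop :=
  [/\ 2 <= `|N|, #|` B| = #|` L|, (2 <= #|` B|)%N
    & hadamard_mx R N B L \is unitarymx].

Definition diff_set (B : {fset int}) : {fset int} :=
  [fset b - b' | b in B, b' in B]%fset.

Definition gcd_fset (S : {fset int}) : int :=
  \big[gcdz/0]_(d <- enum_fset S) d.

(* cB as a set of reals, for a set B of integers *)
Definition scale_fset {R : realType} (c : R) (B : {fset int}) : {fset R} :=
  [fset c * b%:~R | b in B]%fset.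

Section convolution.
Context {R : realType}.
Local Open Scope ereal_scope.

(* (1 / #A) * sum_(a in A) delta_a; the zero measure when A is empty *)
Definition unif_delta (A : {fset R}) : set R -> \bar R :=
  mscale (#|` A|%:R^-1%:nng)%R (msum (fun i => \d_(nth 0%R A i)) #|` A|).

Lemma unif_deltaE (A : {fset R}) (U : set R) :
  unif_delta A U = (#|` A|%:R^-1)%:E * \sum_(i < #|` A|) \d_(nth 0%R A i) U.
Proof. by []. Qed.

HB.instance Definition _ (A : {fset R}) := Measure.on (unif_delta A).

Let unif_delta_fin (A : {fset R}) : fin_num_fun (unif_delta A).
Proof.
apply: lty_fin_num_fun; suff h : unif_delta A [set: R] < +oo by exact: h.
rewrite unif_deltaE (eq_bigr (fun=> 1%:E)) => [|i _]; last exact: diracT.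
by rewrite sumEFin -EFinM ltry.
Qed.

HB.instance Definition _ (A : {fset R}) :=
  Measure_isFinite.Build _ _ _ (unif_delta A) (@unif_delta_fin A).

Definition addR2 (p : R * R) : R := (p.1 + p.2)%R.

Let measurable_addR2 : measurable_fun [set: R * R] addR2.
Proof.
apply: measurable_realfun.measurable_funD.
- exact: measurable_fst.
- exact: measurable_snd.
Qed.

HB.instance Definition _ :=
  isMeasurableFun.Build _ _ (R * R)%type R addR2 measurable_addR2.

Variables mu nu : {finite_measure set R -> \bar R}.

Definition convm : set R -> \bar R := pushforward (mu \x nu) addR2.

Let convm0 : convm set0 = 0.
Proof. by rewrite /convm /pushforward preimage_set0 measure0. Qed.

Let convm_ge0 A : 0 <= convm A.
Proof. exact: measure_ge0. Qed.

Let convm_sigma_additive : semi_sigma_additive convm.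
Proof. exact: measure_semi_sigma_additive. Qed.

HB.instance Definition _ :=
  isMeasure.Build _ _ _ convm convm0 convm_ge0 convm_sigma_additive.

Let convm_fin : fin_num_fun convm.
Proof.
apply: lty_fin_num_fun.
suff h : (mu \x nu) [set: R * R] < +oo by exact: h.
rewrite -setXTT product_measure1E// lte_mul_pinfty//.
- by rewrite ge0_fin_numE// fin_num_fun_lty//; exact: fin_num_measure.
- by apply: fin_num_fun_lty; exact: fin_num_measure.
Qed.

HB.instance Definition _ := Measure_isFinite.Build _ _ _ convm convm_fin.

End convolution.

Section infinite_convolution.
Context {R : realType}.

Fixpoint partial_conv (nu : nat -> {finite_measure set R -> \bar R}) (n : nat) :
    {finite_measure set R -> \bar R} :=
  if n is k.+1 then convm (partial_conv nu k) (nu k.+1) else nu 0.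

Definition weak_cvg (nu : nat -> {finite_measure set R -> \bar R})
    (mu : {finite_measure set R -> \bar R}) : Prop :=
  forall f : R -> R, continuous f -> (exists M, forall x, `|f x| <= M) ->
    (fun n => \int[nu n]_x f x) @ \oo --> \int[mu]_x f x.

Definition is_infinite_convolution
    (nu : nat -> {finite_measure set R -> \bar R})
    (mu : {finite_measure set R -> \bar R}) : Prop :=
  weak_cvg (partial_conv nu) mu.

(* k counts from 0, so the k-th factor rescales by the first k.+1 entries *)
Definition conv_factor (m : nat) (N : 'I_m -> int) (B : 'I_m -> {fset int})
    (omega : nat -> 'I_m) (k : nat) : {finite_measure set R -> \bar R} :=
  unif_delta
    (scale_fset (\prod_(i < k.+1) (N (omega i))%:~R)^-1 (B (omega k))).

End infinite_convolution.

Section spectral_measure.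
Context {R : realType}.
Variable mu : {measure set R -> \bar R}.

Definition in_L2 (f : R -> R[i]) : Prop :=
  [/\ measurable_fun [set: R] (fun x => complex.Re (f x)),
      measurable_fun [set: R] (fun x => complex.Im (f x))
    & (\int[mu]_x ((Normc.normc (f x)) ^+ 2)%:E < +oo)%E].

Definition L2_dot (f g : R -> R[i]) : R[i] :=
  (\int[mu]_x complex.Re (f x * (g x)^*)) +i*
  (\int[mu]_x complex.Im (f x * (g x)^*)).

(* An orthonormal family in L^2(mu) whose finite linear combinations are dense;
   functions stand for their classes modulo mu-a.e. equality. *)
Definition orthonormal_basis (I : choiceType) (D : set I)
    (e : I -> R -> R[i]) : Prop :=
  [/\ forall i, D i -> in_L2 (e i),
      forall i j, D i -> D j -> L2_dot (e i) (e j) = (i == j)%:R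
    & forall f, in_L2 f -> forall eps : R, 0 < eps ->
        exists (s : {fset I}) (c : I -> R[i]), [set` s] `<=` D /\
          (\int[mu]_x ((Normc.normc
             (f x - \sum_(i <- s) c i * e i x)) ^+ 2)%:E < (eps ^+ 2)%:E)%E].

Definition spectral_measure : Prop :=
  exists Lambda : set R, countable Lambda /\
    orthonormal_basis Lambda (fun lambda x => expi (2 * pi * lambda * x)).

End spectral_measure.

(* Main.v *)
(* Write [S_n = N_(w_1) ... N_(w_n)] and [mu = mu_n * rho_n], where [mu_n] is the
   uniform measure on the atoms of the first [n] factors and [rho_n] is the tail.
   The exponentials with frequencies in [l_1 + S_1 l_2 + ... + S_(n-1) l_n]
   ([l_i] in [L_(w_i)]) form a basis of L^2(mu_n), and remain so when every
   frequency is shifted by a multiple of [S_n].  If the shifts can be chosen so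
   that the Fourier transform of [rho_n] is bounded below by a fixed constant at
   the rescaled frequencies, then projecting a Lipschitz function onto these
   exponentials in L^2(mu) reduces its squared norm by a fixed factor, and
   iterating gives density.

   The lower bound amounts to the absence of points [x] such that all [x + k]
   ([k] an integer) are almost zeros of the transform of a tail.  Such an [x]
   would give two such points [(x + l) / N] for the next tail: a single one would
   make the mask of [B] almost unimodular there, hence, as [gcd (B - B) = 1],
   place it near an integer, where the transform is close to 1.  Repeating this
   produces arbitrarily many separated almost zeros in [0, 1[, and Lagrange
   interpolation at these bounds the value at 0 by [K^n / n! + o(1)], whereas this
   value is 1. *)

From HB Require Import structures.
Require Import Defs.
From mathcomp Require Import all_boot all_order all_algebra.
From mathcomp Require Import finmap complex.
From mathcomp Require Import all_classical all_reals all_analysis.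
From mathcomp Require Import spectral measurable_realfun ring lra zify.

Set Implicit Arguments.
Unset Strict Implicit.
Unset Printing Implicit Defensive.

Import Order.TTheory GRing.Theory Num.Theory.
Import numFieldNormedType.Exports.

Local Open Scope classical_set_scope.
Local Open Scope ring_scope.

(** * Complex numbers and means *)

(** Two obstacles shape the argument: the lower bound must be uniform over all tails, and the
    frequency sets must increase although every stage shifts frequencies. For the first, no limit
    tail is ever formed: [rho_n] is represented by the partial transforms [ft (shift n eta) k], with
    bounds valid for every [k], and exact zeros with compactness give way to the tolerance [e] of
    [near_zero]. The tolerance loses a fixed factor per generation, uniform because there are
    finitely many triples, and the number of generations is fixed beforehand by the factorial bound.
    For the second, a frequency once chosen never moves again: after enough further factors
    [l / S_n] is so close to 0 that the tail transform is large there anyway, so only new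
    frequencies are shifted. The measure [mu] is reached only through weak convergence against
    bounded continuous functions: identities are proved for finite lists of atoms and passed to the
    limit. *)

Section complex_squares.
Context {R : realType}.
Implicit Types z w : R[i].

(** The squared modulus as a real polynomial in the two parts, so that identities reduce to [ring]
    after [reimE]. *)
Definition sqn z : R := complex.Re z ^+ 2 + complex.Im z ^+ 2.

Lemma complex_ext z w :
  complex.Re z = complex.Re w -> complex.Im z = complex.Im w -> z = w.
Proof. by case: z => a b; case: w => c d /= -> ->. Qed.

Lemma ReM z w : complex.Re (z * w) =
  complex.Re z * complex.Re w - complex.Im z * complex.Im w.
Proof. by case: z => a b; case: w => c d. Qed.

Lemma ImM z w : complex.Im (z * w) =
  complex.Re z * complex.Im w + complex.Im z * complex.Re w.
Proof. by case: z => a b; case: w => c d. Qed.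

Lemma ReD z w : complex.Re (z + w) = complex.Re z + complex.Re w.
Proof. by case: z => a b; case: w => c d. Qed.

Lemma ImD z w : complex.Im (z + w) = complex.Im z + complex.Im w.
Proof. by case: z => a b; case: w => c d. Qed.

Lemma ReN z : complex.Re (- z) = - complex.Re z.
Proof. by case: z. Qed.

Lemma ImN z : complex.Im (- z) = - complex.Im z.
Proof. by case: z. Qed.

Lemma Reconj z : complex.Re (conjc z) = complex.Re z.
Proof. by case: z. Qed.

Lemma Imconj z : complex.Im (conjc z) = - complex.Im z.
Proof. by case: z. Qed.

Definition reimE := (ReM, ImM, ReD, ImD, ReN, ImN, Reconj, Imconj).

Lemma Re_sum (I : Type) (r : seq I) (P : pred I) (F : I -> R[i]) :
  complex.Re (\sum_(i <- r | P i) F i) = \sum_(i <- r | P i) complex.Re (F i).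
Proof. exact: (big_morph (@complex.Re R) ReD). Qed.

Lemma Im_sum (I : Type) (r : seq I) (P : pred I) (F : I -> R[i]) :
  complex.Im (\sum_(i <- r | P i) F i) = \sum_(i <- r | P i) complex.Im (F i).
Proof. exact: (big_morph (@complex.Im R) ImD). Qed.

Lemma conjcM z w : conjc (z * w) = conjc z * conjc w.
Proof. exact: rmorphM. Qed.

Lemma conjc_sum (I : Type) (r : seq I) (F : I -> R[i]) :
  conjc (\sum_(i <- r) F i) = \sum_(i <- r) conjc (F i).
Proof. exact: rmorph_sum. Qed.

Lemma sqn_ge0 z : 0 <= sqn z.
Proof. by rewrite addr_ge0 ?sqr_ge0. Qed.

Lemma sqnM z w : sqn (z * w) = sqn z * sqn w.
Proof. by rewrite /sqn !reimE; ring. Qed.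

Lemma sqn_conj z : sqn (conjc z) = sqn z.
Proof. by rewrite /sqn !reimE; ring. Qed.

Lemma sqn0 : sqn 0 = 0.
Proof. by rewrite /sqn /= !expr0n addr0. Qed.

Lemma sqn1 : sqn 1 = 1.
Proof. by rewrite /sqn /= expr1n expr0n addr0. Qed.

Lemma sqnC z : (sqn z)%:C%C = z * conjc z.
Proof. by apply: complex_ext; rewrite !reimE /= /sqn; ring. Qed.

Lemma sqn_normc z : Normc.normc z ^+ 2 = sqn z.
Proof. by case: z => a b; rewrite /= sqr_sqrtr// ?addr_ge0 ?sqr_ge0. Qed.

(** The gap is [t^-1] times the squared modulus of [t z - w]. A small [t] leaves the first term
    almost unweighted, which the contraction argument requires. *)
Lemma sqnD_le (t : R) z w : 0 < t ->
  sqn (z + w) <= (1 + t) * sqn z + (1 + t^-1) * sqn w.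
Proof.
move=> t0; rewrite -subr_ge0.
suff -> : (1 + t) * sqn z + (1 + t^-1) * sqn w - sqn (z + w) =
   t^-1 * ((t * complex.Re z - complex.Re w) ^+ 2 +
           (t * complex.Im z - complex.Im w) ^+ 2).
  by rewrite mulr_ge0 ?invr_ge0 ?(ltW t0)// addr_ge0 ?sqr_ge0.
by rewrite /sqn !reimE; field; rewrite gt_eqF.
Qed.

Lemma sqnD_le2 z w : sqn (z + w) <= 2 * sqn z + 2 * sqn w.
Proof.
by have := @sqnD_le 1 z w ltr01; rewrite invr1 -[1 + 1]/(2 : R).
Qed.

End complex_squares.

Section exponential.
Context {R : realType}.
Implicit Types x y : R.

Definition e1 x : R[i] := expi (2 * pi * x).

Lemma e1D x y : e1 (x + y) = e1 x * e1 y.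
Proof.
by rewrite /e1 mulrDr; apply: complex_ext; rewrite !reimE /= ?cosD ?sinD; ring.
Qed.

Lemma e1N x : e1 (- x) = conjc (e1 x).
Proof. by rewrite /e1 mulrN /expi cosN sinN. Qed.

Lemma conj_e1 x : conjc (e1 x) = e1 (- x).
Proof. by rewrite e1N. Qed.

Lemma e10 : e1 0 = 1.
Proof. by rewrite /e1 mulr0 /expi cos0 sin0. Qed.

Lemma sqn_e1 x : sqn (e1 x) = 1.
Proof. exact: cos2Dsin2. Qed.

Lemma e1_int (k : int) : e1 k%:~R = 1.
Proof.
have nat_case (n : nat) : e1 n%:R = 1.
  elim: n => [|n IH]; first by rewrite e10.
  rewrite -natr1 e1D IH mul1r /e1 mulr1 mulrC mulr_natr /expi.
  by rewrite cos2pi sin2pi.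
case: k => n; first exact: nat_case.
by rewrite NegzE mulrNz e1N nat_case conjc1.
Qed.

Lemma e1_periodic x (k : int) : e1 (x + k%:~R) = e1 x.
Proof. by rewrite e1D e1_int mulr1. Qed.

Lemma Re_e1 x : complex.Re (e1 x) = cos (2 * pi * x).
Proof. by []. Qed.

End exponential.

Section mean.
Context {K : fieldType} {T : Type}.
Implicit Types (s : seq T) (f g : T -> K).

(** Repetitions in the list count, so coinciding atoms keep their weight; the empty list gives 0.
    The field is generic because real and complex averages both occur. *)
Definition mean s f : K := (size s)%:R^-1 * \sum_(x <- s) f x.

Lemma eq_mean s f g : f =1 g -> mean s f = mean s g.
Proof. by move=> fg; rewrite /mean; under eq_bigr do rewrite fg. Qed.

Lemma meanD s f g : mean s (fun x => f x + g x) = mean s f + mean s g.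
Proof. by rewrite /mean big_split mulrDr. Qed.

Lemma meanN s f : mean s (fun x => - f x) = - mean s f.
Proof. by rewrite /mean sumrN mulrN. Qed.

Lemma meanZ s f (c : K) : mean s (fun x => c * f x) = c * mean s f.
Proof. by rewrite /mean -mulr_sumr mulrCA. Qed.

Lemma meanZr s f (c : K) : mean s (fun x => f x * c) = mean s f * c.
Proof. by rewrite /mean -mulr_suml mulrA. Qed.

Lemma mean_sum s (I : Type) (r : seq I) (F : I -> T -> K) :
  mean s (fun x => \sum_(i <- r) F i x) = \sum_(i <- r) mean s (F i).
Proof. by rewrite /mean exchange_big -mulr_sumr. Qed.

End mean.

Lemma mean_exchange (K : fieldType) (T U : Type) (s : seq T) (t : seq U)
    (F : T -> U -> K) :
  mean s (fun x => mean t (F x)) = mean t (fun y => mean s (F^~ y)).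
Proof.
by rewrite meanZ mean_sum [RHS]/mean.
Qed.

Lemma mean_allpairs (K : fieldType) (T U V : Type) (s : seq T) (t : seq U)
    (h : T -> U -> V) (F : V -> K) :
  mean [seq h x y | x <- s, y <- t] F =
  mean s (fun x => mean t (fun y => F (h x y))).
Proof.
rewrite {1}/mean size_allpairs natrM invfM big_allpairs_dep.
by rewrite /mean -mulr_sumr mulrA.
Qed.

Lemma mean_const (K : numFieldType) (T : Type) (s : seq T) (c : K) :
  (0 < size s)%N -> mean s (fun=> c) = c.
Proof.
move=> s0; rewrite /mean big_const_seq count_predT iter_addr_0 -(mulr_natr c).
by rewrite mulrCA mulVf ?mulr1// pnatr_eq0 -lt0n.
Qed.

Section real_mean.
Context {R : realType} {T : Type}.
Implicit Types (s : seq T).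

Lemma ler_mean s (f g : T -> R) : (forall x, f x <= g x) ->
  mean s f <= mean s g.
Proof. by move=> fg; rewrite ler_wpM2l ?invr_ge0 ?ler0n// ler_sum. Qed.

Lemma mean_ge0 s (f : T -> R) : (forall x, 0 <= f x) -> 0 <= mean s f.
Proof. by move=> f0; rewrite mulr_ge0 ?invr_ge0 ?ler0n// sumr_ge0. Qed.

Lemma ler_mean_seq (U : eqType) (s : seq U) (f g : U -> R) :
  (forall x, x \in s -> f x <= g x) -> mean s f <= mean s g.
Proof.
by move=> fg; rewrite ler_wpM2l ?invr_ge0 ?ler0n// !big_seq ler_sum.
Qed.

Lemma mean_real_complex s (f : T -> R) :
  mean s (fun x => (f x)%:C%C) = (mean s f)%:C%C.
Proof.
rewrite /mean rmorphM fmorphV rmorph_nat; congr (_ * _).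
by rewrite rmorph_sum.
Qed.

Lemma Re_mean s (f : T -> R[i]) :
  complex.Re (mean s f) = mean s (fun x => complex.Re (f x)).
Proof.
rewrite /mean -Re_sum -[in LHS](rmorph_nat (real_complex R)) -fmorphV ReM /=.
by rewrite mul0r subr0.
Qed.

Lemma Im_mean s (f : T -> R[i]) :
  complex.Im (mean s f) = mean s (fun x => complex.Im (f x)).
Proof.
rewrite /mean -Im_sum -[in LHS](rmorph_nat (real_complex R)) -fmorphV ImM /=.
by rewrite mul0r addr0.
Qed.

Lemma conj_mean s (f : T -> R[i]) :
  conjc (mean s f) = mean s (fun x => conjc (f x)).
Proof.
by apply: complex_ext; rewrite !(Reconj, Imconj) !(Re_mean, Im_mean) -?meanN;
  apply: eq_mean => x; rewrite ?(Reconj, Imconj).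
Qed.

(** The gap is the variance of [f] along the list, itself a mean of squares. *)
Lemma sqr_mean_le s (f : T -> R) : mean s f ^+ 2 <= mean s (fun x => f x ^+ 2).
Proof.
have [s0|s0] := posnP (size s).
  by rewrite /mean s0 invr0 !mul0r expr0n.
rewrite -subr_ge0.
suff <- : mean s (fun x => (f x - mean s f) ^+ 2) =
    mean s (fun x => f x ^+ 2) - mean s f ^+ 2.
  by apply: mean_ge0 => x; exact: sqr_ge0.
under eq_mean do rewrite sqrrB -mulr_natr -mulrA -addrA.
rewrite meanD meanD meanN mean_const//.
by rewrite meanZr; ring.
Qed.

Lemma sqn_mean_le s (f : T -> R[i]) :
  sqn (mean s f) <= mean s (fun x => sqn (f x)).
Proof. by rewrite /sqn Re_mean Im_mean meanD lerD// sqr_mean_le. Qed.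

End real_mean.

(** * Hadamard triples *)

Section hadamard.
Context {R : realType} (N : int) (B L : {fset int}).
Hypothesis tripleH : hadamard_triple R N B L.

Let q := #|` B|.

Let N_neq0 : (N%:~R : R) != 0.
Proof.
have [N2 _ _ _] := tripleH; rewrite intr_eq0.
by apply/eqP => N0; rewrite N0 in N2.
Qed.

Let q_gt0 : 0 < (q%:R : R).
Proof. by have [_ _ q2 _] := tripleH; rewrite ltr0n (ltn_trans _ q2). Qed.

Let H i j := hadamard_mx R N B L i j.

Let H_entry i j : H i j =
  ((Num.sqrt q%:R)^-1)%:C%C * e1 (- ((nth 0 B i)%:~R * (nth 0 L j)%:~R / N%:~R)).
Proof. by rewrite /H mxE /e1; congr (_ * expi _); ring. Qed.

Let scale_sqr : ((Num.sqrt q%:R)^-1)%:C%C * conjc ((Num.sqrt q%:R)^-1)%:C%C =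
  (q%:R^-1 : R)%:C%C.
Proof.
by rewrite conjc_real -rmorphM -invfM -expr2 sqr_sqrtr// ltW.
Qed.

Let entry_conj i j i' j' : H i j * conjc (H i' j') = (q%:R^-1 : R)%:C%C *
  e1 ((nth 0 B i')%:~R * (nth 0 L j')%:~R / N%:~R -
      (nth 0 B i)%:~R * (nth 0 L j)%:~R / N%:~R).
Proof.
by rewrite !H_entry conjcM mulrACA scale_sqr conj_e1 -e1D opprK addrC.
Qed.

Let unscale (z : R[i]) (a : bool) : (q%:R^-1 : R)%:C%C * z = a%:R ->
  z = (q%:R * a%:R : R)%:C%C.
Proof.
move=> E; rewrite rmorphM (rmorph_nat (real_complex R) a) -E mulrA -rmorphM.
by rewrite mulfV ?gt_eqF// mul1r.
Qed.

Lemma hadamard_rows b b' : b \in B -> b' \in B ->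
  \sum_(l <- L) e1 ((b'%:~R - b%:~R) * l%:~R / N%:~R : R) =
  (q%:R * (b == b')%:R : R)%:C%C.
Proof.
move=> bB b'B; have [_ _ _ /unitarymxP U] := tripleH.
have iB : (index b B < #|` B|)%N by rewrite index_mem.
have iB' : (index b' B < #|` B|)%N by rewrite index_mem.
move/matrixP: U => /(_ (Ordinal iB) (Ordinal iB')).
rewrite !mxE => U; apply: unscale.
rewrite mulr_sumr (big_nth 0) big_mkord.
transitivity ((Ordinal iB == Ordinal iB')%:R : R[i]); last first.
  congr (nat_of_bool _)%:R; apply/eqP/eqP => [[]|E]; last first.
    by apply: val_inj; rewrite /= E.
  by move=> /(congr1 (nth 0 B)); rewrite !nth_index.
rewrite -U; apply: eq_bigr => j _.
transitivity (H (Ordinal iB) j * conjc (H (Ordinal iB') j)).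
  by rewrite entry_conj /= !nth_index//; congr (_ * e1 _); ring.
by rewrite /H !mxE.
Qed.

(** Unitarity as stated gives orthonormal rows. Since [#|B| = #|L|] the matrix is square, so its
    adjoint is also a left inverse and the columns are orthonormal too. *)
Lemma hadamard_cols l l' : l \in L -> l' \in L ->
  \sum_(b <- B) e1 (b%:~R * (l'%:~R - l%:~R) / N%:~R : R) =
  (q%:R * (l == l')%:R : R)%:C%C.
Proof.
move=> lL l'L; have [_ BL _ U] := tripleH.
have iL : (index l L < #|` L|)%N by rewrite index_mem.
have iL' : (index l' L < #|` L|)%N by rewrite index_mem.
have := mulmxKtV 1%:M U BL; rewrite mul1mx.
move/matrixP => /(_ (Ordinal iL') (Ordinal iL)).
rewrite !mxE => {}U; apply: unscale.
rewrite mulr_sumr (big_nth 0) big_mkord.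
transitivity ((Ordinal iL' == Ordinal iL)%:R : R[i]); last first.
  congr (nat_of_bool _)%:R; apply/eqP/eqP => [[]|E]; last first.
    by apply: val_inj; rewrite /= E.
  by move=> /(congr1 (nth 0 L)); rewrite !nth_index.
rewrite -U; apply: eq_bigr => j _.
transitivity (H j (Ordinal iL) * conjc (H j (Ordinal iL'))).
  by rewrite entry_conj /= !nth_index//; congr (_ * e1 _); ring.
by rewrite mulrC /H !mxE.
Qed.

(** Expanding the square gives a double mean over [b], [b']; summing over [l] first kills the terms
    with [b != b'] by row orthogonality, and the factor [q] of the diagonal cancels one of the two
    normalisations. *)
Lemma hadamard_parseval (h : int -> R[i]) :
  \sum_(l <- L) sqn (mean B (fun b => h b * e1 (- (b%:~R * l%:~R / N%:~R)))) =
  mean B (fun b => sqn (h b)).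
Proof.
apply: complexI; rewrite rmorph_sum -mean_real_complex.
pose G l b b' := (h b * conjc (h b')) *
  e1 ((b'%:~R - b%:~R) * l%:~R / N%:~R : R).
transitivity (\sum_(l <- L) mean B (fun b => mean B (G l b))).
  apply: eq_bigr => l _ /=; rewrite sqnC conj_mean -meanZr.
  apply: eq_mean => b; rewrite -meanZ; apply: eq_mean => b'.
  rewrite conjcM mulrACA conj_e1 -e1D /G; congr (_ * e1 _); ring.
rewrite -mean_sum /mean; congr (_ * _); rewrite !big_seq.
apply: eq_bigr => b bB; rewrite -mulr_sumr exchange_big /=.
transitivity ((q%:R)^-1 * \sum_(b' <- B | b' == b) (h b * conjc (h b')) * q%:R).
  congr (_ * _); rewrite [RHS]big_mkcond !big_seq; apply: eq_bigr => b' b'B.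
  rewrite /G -mulr_sumr hadamard_rows// eq_sym rmorphM rmorph_nat.
  by case: eqP => [->|_]; rewrite ?mulr1 ?mulr0.
rewrite -big_filter filter_pred1_uniq ?fset_uniq// big_seq1 -sqnC mulrC mulfK//.
by rewrite pnatr_eq0 -lt0n -(ltr0n R).
Qed.

End hadamard.

(** * Masks near their maximum *)

Section near_integers.
Context {R : realType}.

Lemma mem_le_mean (T : eqType) (s : seq T) (f : T -> R) x :
  (forall y, 0 <= f y) -> x \in s -> f x <= (size s)%:R * mean s f.
Proof.
move=> f0 xs; have s0 : (0 < size s)%N by case: s xs.
rewrite /mean mulrA mulfV ?pnatr_eq0 -?lt0n// mul1r.
by rewrite (big_rem x)//= lerDl sumr_ge0.
Qed.

Lemma sqn_e1_sub1 (x : R) : sqn (e1 x - 1) = 2 - 2 * cos (2 * pi * x).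
Proof.
rewrite /sqn !reimE /= oppr0 addr0.
have := cos2Dsin2 (2 * pi * x); set c := cos _; set s := sin _ => cs.
by rewrite -[2]/(1 + 1) -{2}cs; ring.
Qed.

Lemma e1_near1_near_int (d : R) : 0 < d ->
  exists2 t, 0 < t & forall x : R, sqn (e1 x - 1) <= t ->
    exists k : int, `|x - k%:~R| <= d.
Proof.
move=> d0; have pi0 := pi_gt0 R.
(* Capping at 1/2 puts [2 * pi * d'] in [[0, pi]], where the cosine is strictly decreasing. The
   threshold is the value of [sqn (e1 x - 1)] at distance [d'] from the integers. *)
pose d' := Num.min d (1/2).
have d'0 : 0 < d' by rewrite lt_min d0 divr_gt0.
have d'2 : d' <= 1/2 by rewrite ge_min lexx orbT.
have d'pi : 2 * pi * d' \in `[0, pi]%R.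
  by rewrite in_itv/=; apply/andP; split; nra.
exists (2 - 2 * cos (2 * pi * d')).
  rewrite subr_gt0 -[ltRHS]mulr1 ltr_pM2l// -[ltRHS]cos0 ltr_cos//.
    by rewrite !mulr_gt0.
  by rewrite in_itv/= lexx ltW.
move=> x H; exists (Num.floor (x + 1/2)).
set k := Num.floor _.
have := floor_itv (x + 1/2); rewrite -/k => /andP[k1 k2].
rewrite intrD (_ : 1%:~R = 1)// in k2.
have y2 : `|x - k%:~R| <= 1/2 by rewrite ler_norml; apply/andP; split; lra.
apply: (@le_trans _ _ d'); last by rewrite ge_min lexx.
move: H; rewrite -(e1_periodic x (- k)) sqn_e1_sub1 rmorphN/= => H.
rewrite leNgt; apply/negP => dy.
have : cos (2 * pi * `|x - k%:~R|) < cos (2 * pi * d').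
  rewrite ltr_cos//; first by rewrite ltr_pM2l// mulr_gt0.
  by rewrite in_itv/=; apply/andP; split; have := normr_ge0 (x - k%:~R); nra.
rewrite -[2 * pi * `|_|]ger0_norm; last by rewrite mulr_ge0// mulr_ge0 ?ltW.
rewrite normrM normr_id -normrM cos_norm; lra.
Qed.

End near_integers.

Section mask.
Context {R : realType}.
Variable B : {fset int}.

Definition mask (x : R) : R[i] := mean B (fun b => e1 (b%:~R * x)).

Lemma mask_periodic (x : R) (k : int) : mask (x + k%:~R) = mask x.
Proof.
by apply: eq_mean => b; rewrite mulrDr -intrM e1_periodic.
Qed.

(** All terms on the right are nonnegative, so a mask value of modulus close to 1 forces every
    [(b - b') x] to be close to an integer. *)
Lemma one_sub_sqn_mask (x : R) : (0 < #|` B|)%N -> 1 - sqn (mask x) =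
  mean B (fun b => mean B (fun b' =>
    1 - cos (2 * pi * ((b%:~R - b'%:~R) * x)))).
Proof.
move=> B0; rewrite /mask; under [RHS]eq_mean do rewrite meanD mean_const// meanN.
rewrite meanD mean_const// meanN; congr (_ - _).
rewrite -[LHS]/(complex.Re (sqn (mask x))%:C%C) sqnC conj_mean -meanZr Re_mean.
apply: eq_mean => b; rewrite -meanZ Re_mean; apply: eq_mean => b'.
by rewrite conj_e1 -e1D Re_e1 -mulNr -mulrDl.
Qed.

(** Says that [d x] tends to the integers as the mask at [x] becomes unimodular. Such [d] form a
    subgroup of the integers containing all differences [b - b'], hence, by Bezout, their gcd. *)
Let near_one (d : int) := forall t : R, 0 < t -> exists2 k : R, 0 < k &
  forall x, 1 - k <= sqn (mask x) -> sqn (e1 (d%:~R * x) - 1) <= t.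

Let near_one_diff b b' : b \in B -> b' \in B -> near_one (b - b').
Proof.
move=> bB b'B t t0; have B0 : (0 < #|` B|)%N by rewrite cardfs_gt0; apply/fset0Pn; exists b.
have q0 : 0 < (#|` B|%:R : R) by rewrite ltr0n.
(* Each of the two nested means may exceed its largest term only by the factor [#|B|] lost in
   isolating that term; the 2 comes from [sqn (e1 x - 1) = 2 (1 - cos)]. *)
exists (t / (2 * (#|` B|%:R * #|` B|%:R))); first by rewrite divr_gt0 ?mulr_gt0.
move=> x; rewrite lerBlDr addrC -lerBlDr one_sub_sqn_mask// => H.
have pos (u : R) : 0 <= 1 - cos u by rewrite subr_ge0 cos_le1.
pose F b b' := 1 - cos (2 * pi * ((b%:~R - b'%:~R) * x)) : R.
have F1 : F b b' <= #|` B|%:R * mean B (F b).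
  by apply: mem_le_mean => // y; exact: pos.
have F2 : mean B (F b) <= #|` B|%:R * mean B (fun b => mean B (F b)).
  apply: (@mem_le_mean _ _ _ (fun b => mean B (F b))) => // y.
  by apply: mean_ge0 => z; exact: pos.
have F3 : #|` B|%:R * mean B (F b) <= t / 2.
  rewrite (le_trans (ler_wpM2l (ltW q0) F2))// mulrA.
  rewrite (le_trans (ler_wpM2l (ltW (mulr_gt0 q0 q0)) H))//.
  by rewrite invfM mulrCA [X in _ * X]mulrCA mulfV ?mulr1 ?mulf_neq0 ?gt_eqF.
by rewrite sqn_e1_sub1 intrB; move: (le_trans F1 F3); rewrite /F; lra.
Qed.

Let near_oneD d d' : near_one d -> near_one d' -> near_one (d + d').
Proof.
move=> nd nd' t t0; have t4 : 0 < t / 4 by rewrite divr_gt0.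
have [k k0 kP] := nd _ t4; have [k' k'0 k'P] := nd' _ t4.
exists (Num.min k k'); first by rewrite lt_min k0.
move=> x xk; have {}kP : sqn (e1 (d%:~R * x) - 1) <= t / 4.
  by apply: kP; apply: le_trans xk; rewrite lerD2l lerN2 ge_min lexx.
have {}k'P : sqn (e1 (d'%:~R * x) - 1) <= t / 4.
  by apply: k'P; apply: le_trans xk; rewrite lerD2l lerN2 ge_min lexx orbT.
rewrite intrD mulrDl e1D.
have -> : e1 (d%:~R * x) * e1 (d'%:~R * x) - 1 =
  e1 (d%:~R * x) * (e1 (d'%:~R * x) - 1) + (e1 (d%:~R * x) - 1) by ring.
apply: (le_trans (sqnD_le2 _ _)); rewrite sqnM sqn_e1; lra.
Qed.

Let near_oneN d : near_one d -> near_one (- d).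
Proof.
move=> nd t t0; have [k k0 kP] := nd _ t0; exists k => // x /kP.
rewrite !sqn_e1_sub1 rmorphN mulNr mulrN cosN//.
Qed.

Let near_one0 : near_one 0.
Proof.
by move=> t t0; exists 1 => // x _; rewrite mul0r e10 subrr sqn0 ltW.
Qed.

Let near_oneM d (a : int) : near_one d -> near_one (a * d).
Proof.
move=> nd; have nat_case (n : nat) : near_one (n%:Z * d).
  elim: n => [|n IH]; first by rewrite mul0r; exact: near_one0.
  by rewrite intS mulrDl mul1r; exact: near_oneD.
case: a => n; first exact: nat_case.
by rewrite NegzE mulNr; exact: near_oneN.
Qed.

Lemma mask_near1 : gcd_fset (diff_set B) = 1 -> forall d : R, 0 < d ->
  exists2 k, 0 < k & forall x, 1 - k <= sqn (mask x) ->
    exists j : int, `|x - j%:~R| <= d.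
Proof.
move=> gcd1 d d0.
have near_gcd : near_one (gcd_fset (diff_set B)).
  rewrite /gcd_fset big_seq; apply: big_ind => [||_ /imfset2P[b bB [b' b'B ->]]].
  - exact: near_one0.
  - move=> u v nu nv; have [p [r <-]] := Bezoutz u v.
    by apply: near_oneD; exact: near_oneM.
  - exact: near_one_diff.
have [t t0 tP] := e1_near1_near_int d0.
have [k k0 kP] := near_gcd _ t0; exists k => // x /kP.
by rewrite gcd1 mul1r; exact: tP.
Qed.

End mask.

(** * Atoms and Fourier transforms of finite convolutions *)

Lemma cos_lip {R : realType} (x y : R) : `|cos x - cos y| <= `|x - y|.
Proof.
wlog xy : x y / y <= x.
  by move=> W; have [/W//|/ltW/W] := leP y x; rewrite distrC [leRHS]distrC.
have [] := @MVT_segment R cos (fun t => - sin t) y x xy.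
  by apply: continuous_subspaceT => t; exact: continuous_cos.
move=> c _ ->; rewrite normrM normrN ler_piMl ?normr_ge0//.
exact: sin_max.
Qed.

Lemma allpairsA (S T U V W X : Type) (h : S -> T -> X) (f : X -> U -> W)
    (k : T -> U -> V) (g : S -> V -> W) (s : seq S) (t : seq T) (u : seq U) :
  (forall a x y, f (h a x) y = g a (k x y)) ->
  [seq f z y | z <- [seq h a x | a <- s, x <- t], y <- u] =
  [seq g a v | a <- s, v <- [seq k x y | x <- t, y <- u]].
Proof.
move=> fg; elim: s => [//|a s IH].
rewrite !allpairs_cons allpairs_cat IH; congr (_ ++ _).
rewrite allpairs_mapl map_allpairs.
by apply: eq_allpairs => x y.
Qed.

Section system.
Context {R : realType} {J : Type} (N : J -> int) (B : J -> {fset int}).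
Implicit Types eta : nat -> J.

Definition tl eta : nat -> J := fun i => eta i.+1.

Definition shift n eta : nat -> J := fun i => eta (n + i)%N.

Definition scale eta n : R := \prod_(i < n) (N (eta i))%:~R.

(* The atoms of the convolution of the first n factors, listed with
   multiplicity in the lexicographic order of the digits. *)
Fixpoint pts eta n : seq R :=
  if n is k.+1 then
    [seq (b%:~R + x) / (N (eta 0%N))%:~R | b <- B (eta 0%N), x <- pts (tl eta) k]
  else [:: 0].

Definition ft eta n (x : R) : R[i] := mean (pts eta n) (fun t => e1 (t * x)).

Lemma scaleS eta n : scale eta n.+1 = (N (eta 0%N))%:~R * scale (tl eta) n.
Proof. by rewrite /scale big_ord_recl. Qed.

Lemma scaleSr eta n : scale eta n.+1 = scale eta n * (N (eta n))%:~R.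
Proof. by rewrite /scale big_ord_recr. Qed.

Lemma scale_int eta n : exists z : int, scale eta n = z%:~R.
Proof.
by exists (\prod_(i < n) N (eta i)); rewrite /scale rmorph_prod.
Qed.

(** The recursion peels off the first digit; here the product is cut at any depth, the remaining
    factors being a copy of the shifted convolution contracted by [scale eta n]. *)
Lemma pts_split eta n k : pts eta (n + k) =
  [seq x + y / scale eta n | x <- pts eta n, y <- pts (shift n eta) k].
Proof.
elim: n eta => [|n IH] eta.
  rewrite /= /scale big_ord0 cats0 -[LHS]map_id.
  by apply: eq_map => y; rewrite add0r divr1.
rewrite addSn [LHS]/= [X in [seq _ | _ <- X, _ <- _]]/= IH; symmetry.
apply: allpairsA => b x y.
by rewrite scaleS invfM; ring.
Qed.

Lemma size_pts_gt0 eta n : (forall j, 0 < #|` B j|)%N -> (0 < size (pts eta n))%N.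
Proof.
by move=> B0; elim: n eta => [//|n IH] eta; rewrite size_allpairs muln_gt0 B0/=.
Qed.

Lemma mean_pts_split (K : fieldType) eta n k (F : R -> K) :
  mean (pts eta (n + k)) F = mean (pts eta n) (fun x =>
    mean (pts (shift n eta) k) (fun y => F (x + y / scale eta n))).
Proof. by rewrite pts_split mean_allpairs. Qed.

Lemma mean_pts1 (K : fieldType) eta (F : R -> K) :
  mean (pts eta 1) F = mean (B (eta 0%N)) (fun b => F (b%:~R / (N (eta 0%N))%:~R)).
Proof.
rewrite mean_allpairs; apply: eq_mean => b.
by rewrite /mean big_seq1 invr1 mul1r addr0.
Qed.

Lemma ft_split eta n k x :
  ft eta (n + k) x = ft eta n x * ft (shift n eta) k (x / scale eta n).
Proof.
rewrite /ft mean_pts_split -meanZr; apply: eq_mean => t.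
by rewrite -meanZ; apply: eq_mean => y; rewrite -e1D; congr e1; ring.
Qed.

Lemma ft1 eta x : ft eta 1 x = mask (B (eta 0%N)) (x / (N (eta 0%N))%:~R).
Proof.
rewrite /ft mean_pts1; apply: eq_mean => b; congr e1; ring.
Qed.

Lemma ftS eta n x : ft eta n.+1 x =
  mask (B (eta 0%N)) (x / (N (eta 0%N))%:~R) * ft (tl eta) n (x / (N (eta 0%N))%:~R).
Proof. by rewrite -add1n ft_split ft1 {1}/scale big_ord1. Qed.

Section expanding.
Hypothesis N2 : forall j, 2 <= `|N j|.
Hypothesis B_gt0 : forall j, (0 < #|` B j|)%N.

Lemma norm_N_ge2 j : 2 <= `|(N j)%:~R : R|.
Proof. by rewrite -intr_norm (ler_int R 2). Qed.

Lemma N_neq0 j : ((N j)%:~R : R) != 0.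
Proof. by rewrite -normr_gt0 (lt_le_trans _ (norm_N_ge2 j)). Qed.

Lemma scale_neq0 eta n : scale eta n != 0.
Proof. by apply/prodf_neq0 => i _; exact: N_neq0. Qed.

Lemma norm_scale_ge eta n : 2 ^+ n <= `|scale eta n|.
Proof.
elim: n => [|n IH]; first by rewrite /scale big_ord0 normr1.
rewrite scaleSr normrM exprSr ler_pM ?exprn_ge0//.
exact: norm_N_ge2.
Qed.

(** The atoms lie in [(scale eta n)^-1 Z]. This is why transforms and coefficients do not see a
    shift of the frequency by a multiple of [scale eta n]. *)
Lemma pts_scale_int eta n t : t \in pts eta n ->
  exists z : int, t * scale eta n = z%:~R.
Proof.
elim: n eta t => [|n IH] eta t; first by rewrite inE => /eqP->; exists 0; rewrite mul0r.
move=> /allpairsP[[b x] [_ /IH[z xz]] ->] /=.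
have [p pP] := scale_int (tl eta) n.
exists (b * p + z).
rewrite scaleS mulrA divfK ?N_neq0// mulrDl xz pP.
by rewrite intrD intrM.
Qed.

Lemma e1_pts eta n t (k : int) : t \in pts eta n -> e1 (t * (scale eta n * k%:~R)) = 1.
Proof. by move=> /pts_scale_int[z tz]; rewrite mulrA tz -intrM e1_int. Qed.

Lemma ft_periodic eta n x (k : int) : ft eta n (x + scale eta n * k%:~R) = ft eta n x.
Proof.
rewrite /ft /mean; congr (_ * _); rewrite !big_seq; apply: eq_bigr => t tP.
by rewrite mulrDr e1D e1_pts// mulr1.
Qed.

Lemma ft0 eta n : ft eta n 0 = 1.
Proof.
rewrite /ft; under eq_mean do rewrite mulr0 e10.
by rewrite mean_const// size_pts_gt0.
Qed.

Lemma sqn_ft_le1 eta n x : sqn (ft eta n x) <= 1.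
Proof.
apply: (le_trans (sqn_mean_le _ _)).
by under eq_mean do rewrite sqn_e1; rewrite mean_const ?size_pts_gt0.
Qed.

(** Further factors multiply by numbers of modulus at most 1. Hence smallness at one depth persists
    at all larger depths. *)
Lemma sqn_ft_anti eta n n' x : (n <= n')%N -> sqn (ft eta n' x) <= sqn (ft eta n x).
Proof.
move=> /subnKC <-; rewrite ft_split sqnM ler_piMr ?sqn_ge0//.
exact: sqn_ft_le1.
Qed.

Variable C : R.
Hypothesis B_le : forall j b, b \in B j -> `|b%:~R| <= C.

Lemma bound_ge0 eta : 0 <= C.
Proof.
have := B_gt0 (eta 0%N); rewrite cardfs_gt0 => /fset0Pn[b /B_le].
exact: le_trans (normr_ge0 _).
Qed.

(** The digit bound reproduces itself: [(C + C) / 2 = C], as [|N| >= 2]. *)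
Lemma pts_le eta n t : t \in pts eta n -> `|t| <= C.
Proof.
elim: n eta t => [|n IH] eta t.
  by rewrite inE => /eqP->; rewrite normr0 (bound_ge0 eta).
move=> /allpairsP[[b x] [/B_le bC /IH xC ->]] /=.
rewrite normrM normfV ler_pdivrMr ?normr_gt0 ?N_neq0//.
have := ler_normD b%:~R x; have := norm_N_ge2 (eta 0%N); have := bound_ge0 eta.
rewrite /= in bC xC; nra.
Qed.

(** Each phase is at most 1/2 in absolute value, so each cosine, hence the real part of the mean, is
    at least 1/2. The bound is uniform in [eta] and [n]. *)
Lemma sqn_ft_near0 eta n x : 2 * pi * C * `|x| <= 1 / 2 -> 1 / 4 <= sqn (ft eta n x).
Proof.
move=> Hx; have RE : 1 / 2 <= complex.Re (ft eta n x).
  rewrite Re_mean.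
  have -> : 1 / 2 = mean (pts eta n) (fun=> 1 / 2 : R).
    by rewrite mean_const// size_pts_gt0.
  apply: ler_mean_seq => t /pts_le tC.
  have := cos_lip 0 (2 * pi * (t * x)); rewrite cos0 sub0r normrN => H.
  have {}H := le_trans (ler_norm _) H; rewrite Re_e1.
  have : `|2 * pi * (t * x)| <= 1 / 2.
    rewrite (le_trans _ Hx)// !normrM (ger0_norm (ler0n _ 2)).
    by rewrite (ger0_norm (pi_ge0 R)) mulrA ler_wpM2r// ler_wpM2l// mulr_ge0// pi_ge0.
  lra.
rewrite /sqn; have := sqr_ge0 (complex.Im (ft eta n x)); nra.
Qed.

End expanding.
End system.

(** * Lagrange interpolation of the cosine *)

Section interpolation.
Context {R : realType}.

Lemma rolle_seq (f df : R -> R) (a : R) (s : seq R) :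
  (forall x : R, is_derive x 1 f (df x)) ->
  path <%R a s -> all (fun z => f z == 0) (a :: s) ->
  exists s', [/\ size s' = size s, sorted <%R s', all (> a) s' & all (fun z => df z == 0) s'].
Proof.
move=> Hd; elim: s a => [|b s IH] a; first by exists [::].
rewrite [path _ _ _]/= => /andP[ab bs].
rewrite [all _ _]/= => /andP[/eqP fa fs].
have [s' [ss' sort_s' bs' zs']] := IH b bs fs.
have fb : f b = 0 by apply/eqP; move: fs => /= /andP[].
have der (x : R) : derivable f x 1 by have [] := Hd x.
have [//||] := @Rolle R f a b ab _ _ (etrans fa (esym fb)).
  by apply: derivable_within_continuous.
move=> c; rewrite in_itv/= => /andP[ac cb] dc.
have dfc : df c = 0 by rewrite -(@derive_val _ _ _ _ _ _ _ (Hd c)) (@derive_val _ _ _ _ _ _ _ dc).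
exists (c :: s'); split => //=.
- by rewrite ss'.
- rewrite path_min_sorted//; apply: sub_all bs' => z; exact: lt_trans.
- by rewrite ac; apply: sub_all bs' => z; exact: lt_trans.
- by rewrite dfc eqxx.
Qed.

(** Each differentiation costs one zero, so [n + 1] zeros leave one for the [n]-th derivative. *)
Lemma rolle_iter (f : nat -> R -> R) n (s : seq R) :
  (forall k (x : R), is_derive x 1 (f k) (f k.+1 x)) ->
  sorted <%R s -> size s = n.+1 -> all (fun z => f 0%N z == 0) s ->
  exists x, f n x = 0.
Proof.
elim: n f s => [|n IH] f s Hd; case: s => [//|a s] sorted_s [ss] zs.
  by exists a; move: zs => /= /andP[/eqP].
have [s' [ss' ? _ zs']] := rolle_seq (Hd 0%N) sorted_s zs.
by apply: (IH (fun k => f k.+1) s') => //; rewrite ss' ss.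
Qed.

(** The [i]-th Lagrange basis polynomial for the nodes [z], evaluated at 0. *)
Definition lagrange0 n (z : 'I_n -> R) i : R :=
  \prod_(j | j != i) ((0 - z j) / (z i - z j)).

(** The classical interpolation error at 0 for [y |-> cos (x y)]: its [n]-th derivative is at most
    [K ^+ n], and the nodal polynomial at 0 is at most 1 because the nodes lie in [[0, 1]]. *)
Lemma lagrange_cos n (z : 'I_n -> R) (K x : R) : injective z ->
  (forall i, 0 <= z i <= 1) -> `|x| <= K ->
  `|1 - \sum_i lagrange0 z i * cos (x * z i)| <= K ^+ n / n`!%:R.
Proof.
move=> z_inj z01 xK; have K0 : 0 <= K by exact: le_trans xK.
have nf0 : 0 < (n`!%:R : R) by rewrite ltr0n fact_gt0.
(* If 0 is a node the interpolation is exact there; otherwise 0 can serve as an additional node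
   below. *)
have [[i0 zi0]|z_neq0] := pselect (exists i, z i = 0).
  have -> : \sum_i lagrange0 z i * cos (x * z i) = 1.
    rewrite (bigD1 i0)//= big1 ?addr0.
      rewrite zi0 mulr0 cos0 mulr1 /lagrange0 big1// => j ji.
      rewrite zi0 divff// sub0r oppr_eq0 -zi0.
      by apply: contra_neq ji => /z_inj.
    move=> i ii0; rewrite /lagrange0 (bigD1 i0) 1?eq_sym//=.
    by rewrite zi0 subrr !mul0r.
  by rewrite subrr normr0 divr_ge0 ?exprn_ge0// ltW.
pose lag i : {poly R} :=
  (\prod_(j | j != i) (z i - z j)^-1) *: \prod_(j | j != i) ('X - (z j)%:P).
pose W : {poly R} := \prod_j ('X - (z j)%:P).
pose p := \sum_i cos (x * z i) *: lag i.
have lag_eval i y : (lag i).[y] = \prod_(j | j != i) ((y - z j) / (z i - z j)).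
  rewrite hornerZ horner_prod -big_split/=; apply: eq_bigr => j _.
  by rewrite !hornerE mulrC.
have p_eval i : p.[z i] = cos (x * z i).
  rewrite horner_sum (bigD1 i)//= big1 ?addr0.
    rewrite hornerZ lag_eval big1 ?mulr1// => j ji.
    by rewrite divff// subr_eq0; apply: contra_neq ji => /z_inj.
  move=> j ji; rewrite hornerZ lag_eval (bigD1 i) 1?eq_sym//=.
  by rewrite subrr !mul0r mulr0.
have W_eval i : W.[z i] = 0.
  by rewrite horner_prod (bigD1 i)//= !hornerE subrr mul0r.
have W0 : W.[0] != 0.
  rewrite horner_prod; apply/prodf_neq0 => i _; rewrite !hornerE oppr_eq0.
  by apply/eqP => zi; apply: z_neq0; exists i.
have W1 : `|W.[0]| <= 1.
  rewrite horner_prod normr_prod; apply: prodr_ile1 => i _.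
  by rewrite !hornerE normrN normr_ge0 ger0_norm; case/andP: (z01 i).
have p0 : p.[0] = \sum_i lagrange0 z i * cos (x * z i).
  by rewrite horner_sum; apply: eq_bigr => i _; rewrite hornerZ lag_eval mulrC.
(* A multiple of the nodal polynomial is added so that [q] agrees with the cosine at 0 as well as at
   the nodes. Bounding the error amounts to bounding [c], which is read off the [n]-th derivative of
   [q]. *)
pose c := (1 - p.[0]) / W.[0].
pose q := p + c *: W.
have size_W : size W = n.+1.
  by rewrite size_prod_XsubC /index_enum -enumT size_enum_ord.
have size_p : (size p <= n)%N.
  apply: (leq_trans (size_sum _ _ _)); apply/bigmax_leqP => i _.
  apply: (leq_trans (size_scale_leq _ _)); apply: (leq_trans (size_scale_leq _ _)).
  apply: (leq_trans (size_prod_leq _ _)).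
  under eq_bigr do rewrite size_XsubC.
  rewrite sum_nat_const cardC1 card_ord.
  by have := ltn_ord i; lia.
have qn : q^`(n) = (c * n`!%:R)%:P.
  rewrite derivnD derivnZ derivn_poly0// add0r.
  have -> : W^`(n) = (n`!%:R)%:P.
    apply/polyP => i; rewrite coef_derivn coefC.
    case: i => [|i].
      rewrite addn0 ffactnn.
      have -> : W`_n = 1.
        have /monicP := monic_prod_XsubC (index_enum 'I_n) xpredT z.
        by rewrite lead_coefE -/W size_W.
      by [].
    by rewrite nth_default ?mul0rn// size_W addnS ltnS leq_addr.
  by rewrite -mul_polyC -polyCM.
(* Writing the [k]-th derivative of the cosine as a phase shift by [k pi / 2] gives one formula for
   all [k]. *)
pose f k y := x ^+ k * cos (x * y + (pi / 2) *+ k) - q^`(k).[y].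
have Hd k (y : R) : is_derive y 1 (f k) (f k.+1 y).
  pose a : R := pi / 2 *+ k.
  have Di : is_derive y 1 (x *: (@id R) + cst a) x.
    by apply: is_derive_eq; rewrite addr0 /GRing.scale/= mulr1.
  have Dg := is_derive1_comp (is_derive_cos ((x *: (@id R) + cst a) y)) Di.
  have -> : f k = x ^+ k *: (cos \o (x *: (@id R) + cst a)) - horner q^`(k).
    by apply/funext => t.
  apply: is_derive_eq; rewrite /f mulrS addrCA (addrC _ (_ + _)) cosDpihalf derivnS.
  by rewrite exprSr /GRing.scale/=; ring.
pose s := sort <=%R (0 :: [seq z i | i <- enum 'I_n]).
have [th] : exists th, f n th = 0.
  apply: (@rolle_iter f n s Hd).
  - rewrite lt_sorted_uniq_le sort_uniq sort_le_sorted andbT /=.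
    rewrite map_inj_uniq ?enum_uniq// andbT.
    by apply/mapP => -[i _ zi]; apply: z_neq0; exists i.
  - by rewrite size_sort /= size_map size_enum_ord.
  - apply/allP => y; rewrite mem_sort inE => /orP[/eqP->|/mapP[i _ ->]].
      rewrite /f derivn0 expr0 mulr0n addr0 mulr0 cos0 mul1r.
      by rewrite hornerD hornerZ divfK// subrKC subrr.
    rewrite /f derivn0 expr0 mulr0n addr0 mul1r.
    by rewrite hornerD hornerZ W_eval p_eval mulr0 addr0 subrr.
move/eqP; rewrite subr_eq0 qn hornerC => /eqP E.
rewrite -p0; have -> : 1 - p.[0] = c * W.[0] by rewrite divfK.
have -> : c = x ^+ n * cos (x * th + (pi / 2) *+ n) / n`!%:R by rewrite E mulfK ?gt_eqF.
rewrite normrM -[leRHS]mulr1 ler_pM//.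
rewrite normrM (ger0_norm (_ : 0 <= n`!%:R^-1)) ?invr_ge0 ?(ltW nf0)//.
rewrite ler_wpM2r ?invr_ge0 ?(ltW nf0)// normrM normrX.
rewrite -[leRHS]mulr1 ler_pM ?exprn_ge0//; last exact: cos_max.
by rewrite lerXn2r ?nnegrE.
Qed.

End interpolation.

(** * Lower bound for the Fourier transforms of the tails *)

(** The minimum over the finite index set works; it turns constants attached to each triple into a
    single one valid along every sequence [eta]. *)
Lemma fin_uniform {R : realType} (I : finType) (P : I -> R -> Prop) :
  (forall i, exists2 k, 0 < k & P i k) ->
  (forall i k k', k' <= k -> P i k -> P i k') ->
  exists2 k, 0 < k & forall i, P i k.
Proof.
move=> exP antiP.
have [k kP] := choice (fun i => let: ex_intro2 k k0 Pk := exP i in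
  ex_intro (fun k => 0 < k /\ P i k) k (conj k0 Pk)).
exists (\big[Num.min/1]_i k i).
  by apply: lt_bigmin => // i _; case: (kP i).
by move=> i; apply: antiP (kP i).2; exact: bigmin_le.
Qed.

Section children.
Context {R : realType} (N : int) (B L : {fset int}).
Hypothesis tripleH : hadamard_triple R N B L.
Hypothesis gcd1 : gcd_fset (diff_set B) = 1.

Lemma triple_N2 : 2 <= `|N|. Proof. by case: tripleH. Qed.

Lemma triple_B_gt0 : (0 < #|` B|)%N.
Proof. by case: tripleH => _ _ q2 _; exact: leq_trans q2. Qed.

Lemma triple_L_gt0 : (0 < #|` L|)%N.
Proof. by case: tripleH => _ BL q2 _; rewrite -BL; exact: leq_trans q2. Qed.

Lemma triple_mask_orth l l' : l \in L -> l' \in L -> l != l' ->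
  mask B ((l'%:~R - l%:~R) / N%:~R : R) = 0.
Proof.
move=> lL l'L /negbTE ll'; rewrite /mask /mean.
under eq_bigr do rewrite mulrA.
by rewrite (hadamard_cols tripleH lL l'L) ll' mulr0 mulr0.
Qed.

(** Parseval for the unimodular function [b |-> e1 (- (b x / N))], up to conjugation. *)
Lemma triple_sum_mask (x : R) :
  \sum_(l <- L) sqn (mask B ((x + l%:~R) / N%:~R)) = 1.
Proof.
have := hadamard_parseval tripleH (fun b => e1 (- (b%:~R * x / N%:~R))).
under [X in _ = X -> _]eq_mean do rewrite sqn_e1.
rewrite mean_const ?triple_B_gt0//; apply: etrans; apply: eq_bigr => l _.
rewrite -sqn_conj conj_mean; congr sqn; apply: eq_mean => b.
by rewrite conj_e1 -e1D; congr e1; ring.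
Qed.

(** The weights [sqn (mask B ((x + l) / N))] sum to 1 over [L]. Either one of them carries almost
    everything, and then its point is near an integer, or at least two are not small. *)
Lemma two_children (d : R) : 0 < d -> exists2 k : R, 0 < k & forall x : R,
  (exists l, exists2 j : int, 1 / 2 <= sqn (mask B ((x + l%:~R) / N%:~R)) &
     `|(x + l%:~R) / N%:~R - j%:~R| <= d) \/
  (exists l l', [/\ l \in L, l' \in L, l != l',
     k <= sqn (mask B ((x + l%:~R) / N%:~R)) &
     k <= sqn (mask B ((x + l'%:~R) / N%:~R))]).
Proof.
move=> d0; have [k1 k10 k1P] := mask_near1 gcd1 d0.
pose k2 := Num.min k1 (1/2).
have k20 : 0 < k2 by rewrite lt_min k10 divr_gt0.
have q0 : 0 < (#|` L|%:R : R) by rewrite ltr0n triple_L_gt0.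
exists (k2 / #|` L|%:R); first by rewrite divr_gt0.
move=> x; pose a l := sqn (mask B ((x + l%:~R) / N%:~R)).
have [[l lL lP]|none] := pselect (exists2 l, l \in L &
    forall l', l' \in L -> l != l' -> a l' < k2 / #|` L|%:R).
  (* The other weights, fewer than [#|L|] in number, each lie below [k2 / #|L|], so together they
     take at most [k2]. *)
  left; exists l; have al : 1 - k2 <= a l.
    have := triple_sum_mask x; rewrite -/a (big_rem l)//= => <-.
    rewrite -addrA gerDl subr_le0.
    apply: (@le_trans _ _ (\sum_(y <- rem l L) k2 / #|` L|%:R)).
      rewrite !big_seq; apply: ler_sum => y.
      rewrite rem_filter ?fset_uniq// mem_filter /= eq_sym => /andP[yl yL].
      exact/ltW/lP.
    rewrite big_const_seq count_predT iter_addr_0 size_rem//.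
    rewrite -[leLHS]mulr_natr mulrAC ler_pdivrMr// ler_wpM2l ?(ltW k20)// ler_nat.
    exact: leq_pred.
  have [] := k1P ((x + l%:~R) / N%:~R).
    by apply: le_trans al; rewrite lerD2l lerN2 ge_min lexx.
  move=> j jP; exists j => //; apply: le_trans al.
  have : k2 <= 1/2 by rewrite ge_min lexx orbT.
  lra.
right.
have next l : l \in L -> exists2 l', (l' \in L) && (l != l') & k2 / #|` L|%:R <= a l'.
  move=> lL; apply: contrapT => H; apply: none; exists l => // l' l'L ll'.
  rewrite ltNge; apply/negP => K; apply: H; exists l' => //.
  by rewrite l'L.
(* [l0] may itself have small weight; it only serves to find a first heavy [l1], from which a second
   one [l2 != l1] is obtained. *)
have [l0 l0L] : exists l, l \in L.
  by apply/fset0Pn; rewrite -cardfs_gt0 triple_L_gt0.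
have [l1 /andP[l1L _] a1] := next _ l0L.
have [l2 /andP[l2L l12] a2] := next _ l1L.
by exists l1, l2.
Qed.

End children.

Section equipositivity.
Context {R : realType} (m : nat) (N : 'I_m -> int) (B L : 'I_m -> {fset int}).
Hypothesis BL_hadamard : forall j, hadamard_triple R (N j) (B j) (L j).
Hypothesis gcd_B : forall j, gcd_fset (diff_set (B j)) = 1.
Implicit Types eta : nat -> 'I_m.

Let N2 j : 2 <= `|N j|. Proof. exact: triple_N2 (BL_hadamard j). Qed.
Let B_gt0 j : (0 < #|` B j|)%N. Proof. exact: triple_B_gt0 (BL_hadamard j). Qed.

Lemma digits_bounded : exists2 C : R, 0 < C &
  forall j b, b \in B j -> `|b%:~R| <= C.
Proof.
exists (1 + \sum_j \sum_(b <- B j) `|b%:~R|).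
  rewrite ltr_wpDr// sumr_ge0// => j _; rewrite sumr_ge0//.
move=> j b bB; rewrite (bigD1 j)//= (big_rem b)//=.
have S1 : 0 <= \sum_(y <- rem b (B j)) `|y%:~R : R| by rewrite sumr_ge0.
have S2 : 0 <= \sum_(i < m | i != j) \sum_(c <- B i) `|c%:~R : R|.
  by rewrite sumr_ge0// => i _; rewrite sumr_ge0.
lra.
Qed.

(* Quantitative version of "x is a common zero of the Fourier transform
   translated by all integers". *)
Definition near_zero eta (e x : R) :=
  forall k : int, exists n, sqn (ft N B eta n (x + k%:~R)) < e.

Lemma near_zero_le eta e e' x : e <= e' -> near_zero eta e x -> near_zero eta e' x.
Proof. by move=> ee' H k; have [n nP] := H k; exists n; exact: lt_le_trans ee'. Qed.

Lemma near_zero_int eta e x (k : int) : near_zero eta e x ->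
  near_zero eta e (x + k%:~R).
Proof.
by move=> H j; have [n] := H (k + j); rewrite intrD addrA; exists n.
Qed.

(** Translating [x] by [l + N j] translates the child by [j]. The mask is 1-periodic, so it
    contributes the same factor for every [j] and can be divided out. Depth 0 cannot occur, the
    transform being 1 there. *)
Lemma near_zero_child eta e k x (l : int) : 0 < k -> e <= 1 ->
  k <= sqn (mask (B (eta 0%N)) ((x + l%:~R) / (N (eta 0%N))%:~R)) ->
  near_zero eta e x ->
  near_zero (tl eta) (e / k) ((x + l%:~R) / (N (eta 0%N))%:~R).
Proof.
move=> k0 e1 kle H j; have [n] := H (l + N (eta 0%N) * j).
case: n => [|n].
  by rewrite /ft /mean big_seq1 invr1 !mul0r e10 mul1r sqn1 ltNge e1.
rewrite ftS; set N0 := (N (eta 0%N))%:~R : R.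
have N0n : N0 != 0 by exact: N_neq0.
have -> : (x + (l + N (eta 0%N) * j)%:~R) / N0 = (x + l%:~R) / N0 + j%:~R.
  by rewrite intrD intrM -/N0; field.
rewrite mask_periodic sqnM => H1; exists n.
rewrite ltr_pdivlMr// mulrC; apply: le_lt_trans H1.
by rewrite ler_wpM2r// sqn_ge0.
Qed.

Lemma near_zero_two : exists2 k : R, 0 < k & forall eta e x,
  e <= 1 / 8 -> near_zero eta e x ->
  exists l l', [/\ l \in L (eta 0%N), l' \in L (eta 0%N), l != l',
    near_zero (tl eta) (e / k) ((x + l%:~R) / (N (eta 0%N))%:~R) &
    near_zero (tl eta) (e / k) ((x + l'%:~R) / (N (eta 0%N))%:~R)].
Proof.
have [C C0 CP] := digits_bounded.
(* The radius around 0 within which [sqn_ft_near0] applies. *)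
pose d := 1 / (4 * pi * C).
have pi0 := pi_gt0 R.
have d0 : 0 < d by rewrite divr_gt0// !mulr_gt0.
have [k k0 kP] := fin_uniform (P := fun j k => forall x : R,
  (exists l, exists2 i : int, 1 / 2 <= sqn (mask (B j) ((x + l%:~R) / (N j)%:~R)) &
     `|(x + l%:~R) / (N j)%:~R - i%:~R| <= d) \/
  (exists l l', [/\ l \in L j, l' \in L j, l != l',
     k <= sqn (mask (B j) ((x + l%:~R) / (N j)%:~R)) &
     k <= sqn (mask (B j) ((x + l'%:~R) / (N j)%:~R))]))
  (fun j => two_children (BL_hadamard j) (gcd_B j) d0)
  (fun j k k' k'k H x => match H x with
     | or_introl H => or_introl H
     | or_intror (ex_intro l (ex_intro l' (And5 lL l'L ll' a b))) =>
       or_intror (ex_intro _ l (ex_intro _ l'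
         (And5 lL l'L ll' (le_trans k'k a) (le_trans k'k b)))) end).
exists k => // eta e x e8 Hx.
have e1 : e <= 1 by lra.
have [[l [i il id]]|[l [l' [lL l'L ll' a b]]]] := kP (eta 0%N) x; last first.
  by exists l, l'; split => //; exact: near_zero_child.
(* The excluded alternative: this child would be an almost zero with tolerance [2 e <= 1/4], yet its
   translate by [- i] is within [d] of 0, where the squared modulus is at least 1/4. *)
have half0 : 0 < 1 / 2 :> R by lra.
have := near_zero_child half0 e1 il Hx.
move=> /(_ (- i)) [n]; rewrite rmorphN/= ltNge => /negP[].
apply: (@le_trans _ _ (1 / 4)); first by rewrite ler_pdivrMr//; lra.
apply: (sqn_ft_near0 N2 B_gt0 CP).
apply: (le_trans (ler_wpM2l _ id)); first by rewrite !mulr_ge0// ltW.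
rewrite /d; move: (pi : R) pi0 => p p0.
have -> : 2 * p * C * (1 / (4 * p * C)) = 1 / 2 by field; rewrite !gt_eqF.
by [].
Qed.

Let Nmax : R := 1 + \sum_j `|(N j)%:~R|.

Let N_le j : `|(N j)%:~R| <= Nmax.
Proof.
rewrite /Nmax (bigD1 j)//=.
have : 0 <= \sum_(i < m | i != j) `|(N i)%:~R : R| by rewrite sumr_ge0.
lra.
Qed.

Let Nmax_ge1 : 1 <= Nmax.
Proof. by rewrite /Nmax lerDl sumr_ge0. Qed.

(** All points belong to the same generation, hence to one sequence [eta']: every point is replaced
    by a child, and only the point of index 0 contributes a second one. [D] is the product of the
    [N] met on the way; as all [D z_i] agree modulo 1, it yields a quantitative separation. *)
Lemma many_near_zeros n (e' : R) : 0 < e' -> exists2 e : R, 0 < e &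
  forall eta x, near_zero eta e x ->
  exists eta' (z : nat -> R) (D : int), [/\ D != 0, `|D%:~R| <= Nmax ^+ n,
    forall i, (i <= n)%N -> near_zero eta' e' (z i),
    forall i, (i <= n)%N -> exists k : int, D%:~R * z i - x = k%:~R &
    forall i j, (i < j <= n)%N -> forall k : int, z i - z j <> k%:~R].
Proof.
have [k k0 kP] := near_zero_two.
elim: n e' => [|n IH] e' e'0.
  exists e' => // eta x Hx; exists eta, (fun=> x), 1; split => //.
  - by rewrite normr1 expr0.
  - by move=> i _; exists 0; rewrite mul1r subrr.
  - by move=> i j; rewrite leqn0; lia.
(* Tolerances are chosen backwards: passing to children divides by [k], and [near_zero_two] requires
   at most 1/8. *)
pose e'' := Num.min (1 / 8) (e' * k).
have e''0 : 0 < e'' by rewrite lt_min; apply/andP; split; [lra|exact: mulr_gt0].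
have [e e0 eP] := IH _ e''0; exists e => // eta x /eP.
move=> [eta' [z [D [D0 Dle znear zx zinj]]]].
set N0 := N (eta' 0%N); set L0 := L (eta' 0%N).
have N0n : (N0%:~R : R) != 0 by exact: N_neq0.
have e''8 : e'' <= 1 / 8 by rewrite ge_min lexx.
have e''k : e'' / k <= e' by rewrite ler_pdivrMr// ge_min lexx orbT.
have child i : exists ll : int * int, (i <= n)%N ->
    [/\ ll.1 \in L0, ll.2 \in L0, ll.1 != ll.2,
      near_zero (tl eta') e' ((z i + ll.1%:~R) / N0%:~R) &
      near_zero (tl eta') e' ((z i + ll.2%:~R) / N0%:~R)].
  have [il|_] := leqP i n; last by exists (0, 0).
  have [l [l' [lL l'L ll' a b]]] := kP _ _ _ e''8 (znear _ il).
  by exists (l, l') => _; split => //; exact: near_zero_le e''k _.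
have [ll llP] := choice child.
exists (tl eta'), (fun i => if (i <= n)%N then (z i + (ll i).1%:~R) / N0%:~R
  else (z 0%N + (ll 0%N).2%:~R) / N0%:~R), (D * N0); split.
- by rewrite mulf_neq0// -(intr_eq0 R).
- by rewrite intrM normrM exprSr ler_pM//; exact: N_le.
- move=> i _; have [il|_] := leqP i n.
    by have [] := llP _ il.
  by have [] := llP 0%N (leq0n _).
- move=> i _; have [il|_] := leqP i n.
    have [j jP] := zx _ il; exists (j + D * (ll i).1).
    by rewrite !intrD !intrM -jP; field.
  have [j jP] := zx _ (leq0n _); exists (j + D * (ll 0%N).2).
  by rewrite !intrD !intrM -jP; field.
- move=> i j /andP[ij jn] k'; have il : (i <= n)%N by lia.
  rewrite il; have [jl|jl] := leqP j n.
    move=> H; apply: (zinj i j _ (N0 * k' - (ll i).1 + (ll j).1)); first by lia.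
    rewrite intrD intrB intrM -H; by field.
  have [i0|i0] := posnP i; last first.
    move=> H; apply: (zinj 0%N i _ (- (N0 * k' - (ll i).1 + (ll 0%N).2))); first by lia.
    rewrite rmorphN /= intrD intrB intrM -H; by field.
  (* Remaining case: the two siblings born from index 0. Were they congruent modulo 1, the mask at
     their difference would be 1, whereas orthogonality of the columns makes it 0. In the earlier
     cases, congruent children would have had congruent parents. *)
  have [a b c _ _] := llP 0%N (leq0n _).
  rewrite i0 => H; have := triple_mask_orth (BL_hadamard _) b a.
  rewrite eq_sym => /(_ c).
  have -> : ((ll 0%N).1%:~R - (ll 0%N).2%:~R) / N0%:~R = 0 + k'%:~R :> R.
    rewrite -H; field => //.
  rewrite mask_periodic => /eqP; apply/negP.
  rewrite /mask; under eq_mean do rewrite mulr0 e10.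
  by rewrite mean_const// oner_eq0.
Qed.

Let exp_coeff_small (K : R) : exists n, K ^+ n.+1 / n.+1`!%:R <= 1 / 2.
Proof.
have /cvgrPdist_le/(_ (1/2)) [|n _ nP] := @cvg_exp_coeff R K; first by lra.
exists n; have := nP n.+1 (leqnSn _).
by rewrite /= sub0r normrN; apply: le_trans; exact: ler_norm.
Qed.

(** The order of choices avoids circularity: [n] depends only on [C], then [S] bounds [|D|] and so
    gives separation [1 / S] and interpolation coefficients at most [S ^+ n], and only then is the
    tolerance fixed. *)
Lemma no_near_zero : exists2 e : R, 0 < e & forall eta x, ~ near_zero eta e x.
Proof.
have [C C0 CP] := digits_bounded.
have pi0 := pi_gt0 R.
have [n nP] := exp_coeff_small (2 * pi * C).
pose S := Nmax ^+ n; have S1 : 1 <= S by exact: exprn_ege1.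
have Sn1 : 1 <= S ^+ n by exact: exprn_ege1.
have Sn0 : 0 < S ^+ n by exact: lt_le_trans Sn1.
(* Makes [n + 1] terms, each at most [S ^+ n * t], add up to 1/4. *)
pose t : R := 1 / (4 * n.+1%:R * S ^+ n).
have t0 : 0 < t by rewrite divr_gt0// !mulr_gt0// ltr0n.
have [e e0 eP] := many_near_zeros n (exprn_gt0 2 t0).
exists e => // eta x /eP[eta' [z [D [D0 Dle znear zx zinj]]]].
pose y (i : 'I_n.+1) := z i - (Num.floor (z i))%:~R.
have y01 i : 0 <= y i <= 1.
  have /andP[] := floor_itv (z i); rewrite intrD (_ : 1%:~R = 1)// => a b.
  by apply/andP; split; rewrite /y; lra.
have ynear i : exists M, sqn (ft N B eta' M (y i)) < t ^+ 2.
  have [M] := near_zero_int (- Num.floor (z i)) (znear i (ltn_ord i)) 0.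
  by rewrite addr0 rmorphN; exists M.
have [M MP] := choice ynear.
(* One depth at which all the [y i] are small simultaneously, by monotonicity in the depth. *)
pose M0 := (\max_i M i)%N.
have yM i : `|complex.Re (ft N B eta' M0 (y i))| <= t.
  rewrite -ler_sqr ?nnegrE ?(ltW t0)// real_normK ?num_real// ltW//.
  apply: le_lt_trans (MP i).
  apply: (le_trans _ (sqn_ft_anti N B_gt0 eta' (y i) (leq_bigmax i))).
  by rewrite /sqn lerDl sqr_ge0.
have ysep i j : i != j -> 1 <= S * `|y i - y j|.
  wlog ij : i j / (i < j)%N.
    move=> W ij; have [/W->//|ji|/val_inj E] := ltngtP i j.
      by rewrite distrC W// eq_sym.
    by rewrite E eqxx in ij.
  move=> _; have [ki kiP] := zx i (ltn_ord i); have [kj kjP] := zx j (ltn_ord j).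
  pose a := ki - kj - D * Num.floor (z i) + D * Num.floor (z j).
  (* Both [D z_i] and [D z_j] differ from [x] by an integer, so [D (y_i - y_j)] is an integer; it is
     nonzero, hence at least 1 in absolute value. *)
  have aE : D%:~R * (y i - y j) = a%:~R.
    by rewrite /a /y !(intrD, mulrNz, intrM) -kiP -kjP; ring.
  apply: (@le_trans _ _ `|a%:~R|); last by rewrite -aE normrM ler_wpM2r.
  rewrite -intr_norm (ler_int R 1) -gtz0_ge1 normr_gt0.
  apply/eqP => az; move: aE; rewrite az => /eqP.
  rewrite mulf_eq0 intr_eq0 (negbTE D0)/= subr_eq0 => /eqP yij.
  apply: (zinj i j _ (Num.floor (z i) - Num.floor (z j))).
    by rewrite ij -ltnS ltn_ord.
  by rewrite intrB; move: yij; rewrite /y; lra.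
have y_inj : injective y.
  move=> i j yij; apply/eqP; apply: contraT => /ysep.
  by rewrite yij subrr normr0 mulr0 ler10.
have lag_le i : `|lagrange0 y i| <= S ^+ n.
  rewrite /lagrange0 normr_prod.
  apply: (@le_trans _ _ (\prod_(j < n.+1 | j != i) S)).
    apply: ler_prod => j ji; rewrite normr_ge0 /= sub0r normrM normrN normfV.
    have /andP[yj0 yj1] := y01 j; rewrite ger0_norm//.
    rewrite eq_sym in ji; have yij := ysep _ _ ji.
    have yij0 : 0 < `|y i - y j|.
      by rewrite normr_gt0 subr_eq0; apply: contra_neq ji => /y_inj.
    by rewrite ler_pdivrMr//; apply: le_trans yij.
  by rewrite prodr_const cardC1 card_ord.
(* The real part of the transform at [y i] is the mean over the atoms [s] of [cos (2 pi s y_i)].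
   Interpolation is applied atom by atom with [x = 2 pi s], which [2 pi C] bounds. *)
have : 1 - \sum_i lagrange0 y i * complex.Re (ft N B eta' M0 (y i)) <= 1 / 2.
  apply: le_trans nP.
  have -> : 1 - \sum_i lagrange0 y i * complex.Re (ft N B eta' M0 (y i)) =
      mean (pts N B eta' M0) (fun s =>
        1 - \sum_i lagrange0 y i * cos (2 * pi * s * y i)).
    rewrite meanD mean_const ?size_pts_gt0// meanN mean_sum; congr (_ - _).
    apply: eq_bigr => i _; rewrite meanZ Re_mean; congr (_ * _).
    by apply: eq_mean => s; rewrite Re_e1 mulrA.
  set b := _ / _; have -> : b = mean (pts N B eta' M0 : seq R) (fun=> b).
    by rewrite mean_const// size_pts_gt0.
  apply: ler_mean_seq => s /(pts_le N2 B_gt0 CP) sC.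
  apply: (le_trans (ler_norm _)); apply: lagrange_cos => //.
  by rewrite !normrM (ger0_norm (ler0n _ 2)) (gtr0_norm pi0) ler_wpM2l// mulr_ge0// ltW.
suff : \sum_i lagrange0 y i * complex.Re (ft N B eta' M0 (y i)) <= 1 / 4 by lra.
apply: (@le_trans _ _ (\sum_(i < n.+1) S ^+ n * t)).
  apply: ler_sum => i _; apply: (le_trans (ler_norm _)).
  by rewrite normrM ler_pM.
rewrite sumr_const card_ord -[leLHS]mulr_natr.
have n0 : 0 < (n.+1%:R : R) by rewrite ltr0n.
have -> : S ^+ n * t * n.+1%:R = 1 / 4.
  rewrite /t; move: (S ^+ n) Sn0 (n.+1%:R : R) n0 => u u0 v v0.
  by field; rewrite !gt_eqF.
by [].
Qed.

(** The translation [k] is chosen before the depth [n], so one integer serves all partial tails at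
    once. *)
Lemma equipositive : exists2 e : R, 0 < e & forall eta x,
  exists k : int, forall n, e <= sqn (ft N B eta n (x + k%:~R)).
Proof.
have [e e0 eP] := no_near_zero; exists e => // eta x.
apply: contrapT => H; apply: (eP eta x) => k; apply: contrapT => Hk.
apply: H; exists k => n; rewrite leNgt; apply/negP => lt.
by apply: Hk; exists n.
Qed.

End equipositivity.

(** * Spectra of finite convolutions *)

Section discrete_spectra.
Context {R : realType} {J : Type} (N : J -> int) (B : J -> {fset int}).
(** Stands for a translate of [L j] containing 0: with the digit 0 available, extending a spectrum
    by one factor keeps the old frequencies. *)
Variable Ls : J -> seq int.
Implicit Types eta : nat -> J.
Hypothesis N2 : forall j, 2 <= `|N j|.
Hypothesis B_gt0 : forall j, (0 < #|` B j|)%N.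
Hypothesis Ls0 : forall j, 0 \in Ls j.
Hypothesis Ls_uniq : forall j, uniq (Ls j).
Hypothesis Ls_orth : forall j l l', l \in Ls j -> l' \in Ls j -> l != l' ->
  mask (B j) ((l'%:~R - l%:~R) / (N j)%:~R : R) = 0.
Hypothesis Ls_parseval : forall j (h : int -> R[i]),
  \sum_(l <- Ls j) sqn (mean (B j) (fun b => h b * e1 (- (b%:~R * l%:~R / (N j)%:~R)))) =
  mean (B j) (fun b => sqn (h b)).

Local Notation scale := (@scale R J N).
Local Notation pts := (@pts R J N B).
Local Notation ft := (@ft R J N B).

Definition scalez eta n : int := \prod_(i < n) N (eta i).

Lemma scalezE eta n : scale eta n = (scalez eta n)%:~R.
Proof. by rewrite /scalez rmorph_prod. Qed.

Lemma scalez_neq0 eta n : scalez eta n != 0.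
Proof. by rewrite -(intr_eq0 R) -scalezE scale_neq0. Qed.

Definition coef eta n (f : R -> R[i]) (x : R) : R[i] :=
  mean (pts eta n) (fun t => f t * e1 (- (t * x))).

(** Completeness is expressed by Parseval's identity for all [f], a form that passes to one more
    factor by applying two such identities in turn. *)
Record discrete_spectrum eta n (s : seq int) : Prop := DiscreteSpectrum {
  spectrum_uniq : uniq s;
  spectrum_orth : forall l l', l \in s -> l' \in s -> l != l' ->
    ft eta n (l'%:~R - l%:~R) = 0;
  spectrum_parseval : forall f : R -> R[i],
    \sum_(l <- s) sqn (coef eta n f l%:~R) = mean (pts eta n) (fun t => sqn (f t)) }.

Lemma discrete_spectrum0 eta : discrete_spectrum eta 0 [:: 0].
Proof.
split=> // [l l'|f]; first by rewrite !inE => /eqP-> /eqP->; rewrite eqxx.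
by rewrite /coef /mean /= !big_seq1 !invr1 !mul1r mul0r oppr0 e10 mulr1.
Qed.

Lemma ft_int_neq0 eta n (k : int) : ft eta n (scale eta n * k%:~R) != 0.
Proof. by rewrite -[X in ft _ _ X]add0r ft_periodic// ft0// oner_eq0. Qed.

(** At a multiple of [scale eta n] the transform equals its value 1 at 0, so distinct orthogonal
    frequencies are never congruent. Individual shifts therefore cannot create repetitions. *)
Lemma spectrum_mod_inj eta n s l l' (k k' : int) : discrete_spectrum eta n s ->
  l \in s -> l' \in s ->
  l + scalez eta n * k = l' + scalez eta n * k' -> l = l'.
Proof.
move=> [_ orth _] ls l's E; apply/eqP; apply: contraT => ll'.
have := orth _ _ ls l's ll'; rewrite -intrB.
have -> : l' - l = scalez eta n * (k - k') by rewrite mulrBr; lia.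
by rewrite intrM -scalezE => /eqP; rewrite (negbTE (ft_int_neq0 _ _ _)).
Qed.

Lemma coef_mod eta n f x (k : int) :
  coef eta n f (x + scale eta n * k%:~R) = coef eta n f x.
Proof.
rewrite /coef /mean; congr (_ * _); rewrite !big_seq; apply: eq_bigr => t tP.
by rewrite mulrDr opprD e1D [e1 (- (t * (_ * _)))]e1N (e1_pts N2 k tP) conjc1 mulr1.
Qed.

Lemma spectrum_translate eta n s (k : int -> int) : discrete_spectrum eta n s ->
  discrete_spectrum eta n [seq l + scalez eta n * k l | l <- s].
Proof.
move=> S; have [us orth pars] := S; split.
- by rewrite map_inj_in_uniq// => l l' ls l's; exact: spectrum_mod_inj S _ _.
- move=> _ _ /mapP[l ls ->] /mapP[l' l's ->] ll'.
  have -> : (l' + scalez eta n * k l')%:~R - (l + scalez eta n * k l)%:~R =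
      (l'%:~R - l%:~R) + scale eta n * (k l' - k l)%:~R.
    by rewrite scalezE !(intrD, mulrNz, intrM); ring.
  rewrite ft_periodic//; apply: orth => //; apply: contraNneq ll' => ->.
  exact: eqxx.
- move=> f; rewrite -pars big_map; apply: eq_bigr => l _.
  by rewrite intrD intrM -scalezE coef_mod.
Qed.

(** For distinct [l] the first [n] factors already give orthogonality; for equal [l] the new mask
    does. Parseval is applied first in [a], for fixed [l], and then in [l], for each new digit
    [b]. *)
Lemma spectrum_extend1 eta n s : discrete_spectrum eta n s ->
  discrete_spectrum eta n.+1 [seq l + scalez eta n * a | l <- s, a <- Ls (eta n)].
Proof.
move=> S; have [us orth pars] := S.
have En : shift n eta 0%N = eta n by rewrite /shift addn0.
split.
- apply: allpairs_uniq => //.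
  move=> [l a] [l' a'] /allpairsP[[u v] [us' _ [-> ->]]].
  move=> /allpairsP[[u' v'] [u's _ [-> ->]]] /= E.
  have /= uu := spectrum_mod_inj S us' u's E; move: E; rewrite uu => /addrI.
  by move=> /(mulfI (scalez_neq0 _ _)) ->.
- move=> _ _ /allpairsP[[l a] [/= ls aL ->]] /allpairsP[[l' a'] [/= l's a'L ->]] ll'.
  rewrite -addn1 ft_split ft1 En.
  have -> : (l' + scalez eta n * a')%:~R - (l + scalez eta n * a)%:~R =
      (l'%:~R - l%:~R) + scale eta n * (a' - a)%:~R :> R.
    by rewrite scalezE !(intrD, mulrNz, intrM); ring.
  have [E|E] := eqVneq l l'; last by rewrite ft_periodic// orth// mul0r.
  rewrite E subrr add0r intrB [scale eta n * _]mulrC mulfK ?scale_neq0// Ls_orth ?mulr0//.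
  by apply: contraNneq ll' => ->; rewrite E.
- move=> f; rewrite -addn1 [RHS]mean_pts_split [RHS]mean_exchange [RHS]mean_pts1 En.
  rewrite big_allpairs_dep /=.
  transitivity (\sum_(l <- s) mean (B (eta n)) (fun b =>
     sqn (coef eta n (fun t => f (t + b%:~R / (N (eta n))%:~R / scale eta n)) l%:~R))).
    apply: eq_bigr => l _.
    (* The function of the new digit whose expansion along [Ls] gives the coefficients at
       [l + scalez eta n * a]: the coefficient of a translate of [f], times a phase. *)
    pose h b := coef eta n (fun t => f (t + b%:~R / (N (eta n))%:~R / scale eta n)) l%:~R *
      e1 (- (b%:~R / (N (eta n))%:~R / scale eta n * l%:~R)).
    transitivity (mean (B (eta n)) (fun b => sqn (h b))); last first.
      by apply: eq_mean => b; rewrite /h sqnM sqn_e1 mulr1.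
    rewrite -Ls_parseval; apply: eq_bigr => a _; congr sqn.
    rewrite /coef mean_pts_split mean_exchange mean_pts1 En.
    apply: eq_mean => b; rewrite /h /coef -!meanZr.
    rewrite /mean; congr (_ * _); rewrite !big_seq; apply: eq_bigr => t tP.
    (* The cross phase [t * scale eta n * a] is trivial at the atoms [t], which decouples old and
       new digits. *)
    have := e1_pts N2 a tP; rewrite scalezE => et.
    rewrite -!mulrA; congr (_ * _); rewrite -!e1D.
    rewrite -[LHS]mulr1 -{1}et -e1D; congr e1.
    have := @scale_neq0 R J N N2 eta n; rewrite scalezE intrD intrM => sn.
    by field; rewrite sn N_neq0.
  by rewrite -mean_sum; apply: eq_mean => b; rewrite pars.
Qed.

Lemma spectrum_extend eta n n' s : (n <= n')%N -> discrete_spectrum eta n s ->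
  exists2 s', discrete_spectrum eta n' s' & {subset s <= s'}.
Proof.
move=> /subnKC <-; elim: (n' - n)%N => [|k IH] S.
  by exists s; rewrite ?addn0.
have [s' S' ss'] := IH S; exists [seq l + scalez eta (n + k) * a |
    l <- s', a <- Ls (eta (n + k)%N)]; first by rewrite addnS; exact: spectrum_extend1.
move=> l /ss' ls'; apply/allpairsP; exists (l, 0); split => //=.
by rewrite mulr0 addr0.
Qed.

Variables (C c0 : R).
Hypothesis C_gt0 : 0 < C.
Hypothesis c0_gt0 : 0 < c0.
Hypothesis B_le : forall j b, b \in B j -> `|b%:~R| <= C.
Hypothesis equipos : forall eta x,
  exists k : int, forall n, c0 <= sqn (ft eta n (x + k%:~R)).

(** [1 / 4] serves the retained frequencies, by closeness to 0, and [c0] the shifted ones. *)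
Let c := Num.min c0 (1 / 4).

Definition tail_positive eta n (s : seq int) := forall l, l \in s ->
  forall k, c <= sqn (ft (shift n eta) k (l%:~R / scale eta n)).

Lemma spectrum_step eta n s : discrete_spectrum eta n s ->
  exists n' s', [/\ (n < n')%N, discrete_spectrum eta n' s',
    {subset s <= s'} & tail_positive eta n' s'].
Proof.
move=> S; have pi0 := pi_gt0 R.
pose T : R := \sum_(l <- s) `|l%:~R|.
(* Since [|scale eta n'| >= 2 ^+ n' >= n'], this depth brings every old [l / scale eta n'] into the
   range of [sqn_ft_near0]. *)
have [n1 n1P] : exists n1, 4 * pi * C * T <= n1%:R.
  exists (Num.bound (4 * pi * C * T)); apply/ltW/archi_boundP.
  by rewrite mulr_ge0// ?sumr_ge0// !mulr_ge0// ltW.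
pose n' := maxn n.+1 n1.
have nn' : (n < n')%N by rewrite leq_max ltnSn.
have [s' S' ss'] := spectrum_extend (ltnW nn') S.
have small l : l \in s -> forall k,
    c <= sqn (ft (shift n' eta) k (l%:~R / scale eta n')).
  move=> ls k; apply: (@le_trans _ _ (1 / 4)); first by rewrite ge_min lexx orbT.
  apply: (sqn_ft_near0 N2 B_gt0 B_le).
  have lT : `|l%:~R : R| <= T by rewrite /T (big_rem l)//= lerDl sumr_ge0.
  have P0 : 0 < `|scale eta n'| by rewrite normr_gt0 scale_neq0.
  rewrite normrM normfV mulrA ler_pdivrMr//.
  have P2 : (n'%:R : R) <= `|scale eta n'|.
    apply: le_trans (@norm_scale_ge R J N N2 eta n').
    by rewrite -natrX ler_nat ltnW// ltn_expl.
  have n1n' : (n1%:R : R) <= n'%:R by rewrite ler_nat leq_max leqnn orbT.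
  have : 4 * pi * C * `|l%:~R| <= 4 * pi * C * T by rewrite ler_wpM2l// !mulr_ge0// ltW.
  lra.
have exk l : exists k : int, forall i,
    c <= sqn (ft (shift n' eta) i (l%:~R / scale eta n' + k%:~R)).
  have [k kP] := equipos (shift n' eta) (l%:~R / scale eta n').
  by exists k => i; apply: le_trans (kP i); rewrite ge_min lexx.
have [k kP] := choice exk.
(* Old frequencies stay in place, which keeps the spectra nested; shifting [l] by
   [scalez eta n' * k] translates the rescaled frequency by [k]. *)
pose k' l := if l \in s then 0 else k l.
exists n', [seq l + scalez eta n' * k' l | l <- s']; split => //.
- exact: spectrum_translate.
- move=> l ls; apply/mapP; exists l; first exact: ss'.
  by rewrite /k' ls mulr0 addr0.
- move=> _ /mapP[l ls' ->] i.
  have -> : (l + scalez eta n' * k' l)%:~R / scale eta n' =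
      l%:~R / scale eta n' + (k' l)%:~R.
    by rewrite intrD intrM -scalezE; field; exact: scale_neq0.
  rewrite /k'; case: ifPn => ls; last exact: kP.
  by rewrite addr0; exact: small.
Qed.

Lemma spectrum_sequence eta : exists (n : nat -> nat) (s : nat -> seq int),
  forall i, [/\ (i <= n i)%N, discrete_spectrum eta (n i) (s i),
    tail_positive eta (n i) (s i) & {subset s i <= s i.+1}].
Proof.
have step (x : nat * seq int) : exists y : nat * seq int,
    discrete_spectrum eta x.1 x.2 ->
    [/\ (x.1 < y.1)%N, discrete_spectrum eta y.1 y.2,
        {subset x.2 <= y.2} & tail_positive eta y.1 y.2].
  have [S|nS] := pselect (discrete_spectrum eta x.1 x.2); last by exists x.
  by have [n' [s' H]] := spectrum_step S; exists (n', s').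
have [F FP] := choice step.
pose D i := iter i F (0%N, [:: 0]).
have DS i : discrete_spectrum eta (D i).1 (D i).2.
  by elim: i => [|i /FP[]//]; exact: discrete_spectrum0.
(* The initial pair is skipped: tail positivity is only guaranteed after one step. *)
exists (fun i => (D i.+1).1), (fun i => (D i.+1).2) => i.
have [a b _ d] := FP _ (DS i); split => //.
  have leD k : (k <= (D k).1)%N.
    by elim: k => // k IH; have [kD _ _ _] := FP _ (DS k); exact: leq_ltn_trans kD.
  exact: ltnW (leD _).
by have [_ _] := FP _ (DS i.+1).
Qed.

(** If [f] were constant at scale [C / |scale eta n|], the coefficient at depth [n + k] would be the
    one at depth [n] times the tail transform. The defect [d l] is controlled by Parseval for
    [f - f (. + y / scale eta n)], and the tail bound together with Parseval for [f] gives the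
    claim. *)
Lemma coef_tail eta n s k (f : R -> R[i]) (e : R) : discrete_spectrum eta n s ->
  tail_positive eta n s ->
  (forall x y, `|y| <= C -> sqn (f x - f (x + y / scale eta n)) <= e) ->
  c * mean (pts eta n) (fun t => sqn (f t)) <=
  2 * (\sum_(l <- s) sqn (coef eta (n + k) f l%:~R)) + 2 * e.
Proof.
move=> S tail fe; have [_ _ pars] := S.
pose d (l : int) := mean (pts (shift n eta) k) (fun y =>
  e1 (- (y / scale eta n * l%:~R)) *
  coef eta n (fun x => f x - f (x + y / scale eta n)) l%:~R).
have crE l : coef eta n f l%:~R * ft (shift n eta) k (- (l%:~R / scale eta n)) =
    coef eta (n + k) f l%:~R + d l.
  rewrite /ft -meanZ {2}/coef mean_pts_split mean_exchange /d -meanD.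
  apply: eq_mean => y; rewrite /coef -meanZr -meanZ -meanD.
  apply: eq_mean => x.
  have -> : - ((x + y / scale eta n) * l%:~R) = - (x * l%:~R) + - (y / scale eta n * l%:~R).
    by ring.
  have -> : y * - (l%:~R / scale eta n) = - (y / scale eta n * l%:~R) by ring.
  by rewrite e1D; ring.
have ftN x : sqn (ft (shift n eta) k (- x)) = sqn (ft (shift n eta) k x).
  rewrite -sqn_conj conj_mean; congr sqn; apply: eq_mean => t.
  by rewrite conj_e1 mulrN opprK.
have cr l : l \in s -> c * sqn (coef eta n f l%:~R) <=
    2 * sqn (coef eta (n + k) f l%:~R) + 2 * sqn (d l).
  move=> ls; apply: le_trans (sqnD_le2 _ _); rewrite -crE sqnM ftN mulrC.
  by rewrite ler_wpM2l ?sqn_ge0// tail.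
have dle : \sum_(l <- s) sqn (d l) <= e.
  apply: (@le_trans _ _ (\sum_(l <- s) mean (pts (shift n eta) k) (fun y =>
     sqn (coef eta n (fun x => f x - f (x + y / scale eta n)) l%:~R)))).
    apply: ler_sum => l _; apply: (le_trans (sqn_mean_le _ _)).
    by apply: ler_mean => y; rewrite sqnM sqn_e1 mul1r.
  rewrite -mean_sum; under eq_mean do rewrite pars.
  have <- : mean (pts (shift n eta) k : seq R) (fun=> e) = e.
    by rewrite mean_const// size_pts_gt0.
  apply: ler_mean_seq => y /(pts_le N2 B_gt0 B_le) yC.
  have <- : mean (pts eta n : seq R) (fun=> e) = e.
    by rewrite mean_const// size_pts_gt0.
  by apply: ler_mean => x; exact: fe.
rewrite -pars mulr_sumr.
apply: (@le_trans _ _ (\sum_(l <- s) (2 * sqn (coef eta (n + k) f l%:~R) + 2 * sqn (d l)))).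
  by rewrite !big_seq; apply: ler_sum => l; exact: cr.
by rewrite big_split -!mulr_sumr lerD2l ler_wpM2l.
Qed.

End discrete_spectra.

(** * Integrals against finite convolutions *)

Section convolution_integrals.
Context {R : realType}.

Lemma measurable_addR2 : measurable_fun [set: R * R] (@addR2 R).
Proof.
apply: measurable_funD.
- exact: measurable_fst.
- exact: measurable_snd.
Qed.

Lemma ge0_integral_unif_delta (A : {fset R}) (f : R -> R) :
  measurable_fun [set: R] f -> (forall x, 0 <= f x) ->
  (\int[unif_delta A]_x (f x)%:E)%E = (mean A f)%:E.
Proof.
move=> mf f0; have mEf : measurable_fun [set: R] (EFin \o f) by exact/measurable_EFinP.
rewrite /unif_delta ge0_integral_mscale//; last by move=> x _; rewrite lee_fin.
rewrite (@ge0_integral_measure_sum _ _ _ (fun i => \d_(nth 0 A i)))//; last first.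
  by move=> x _; rewrite lee_fin.
under eq_bigr do rewrite integral_dirac// diracT mul1e.
by rewrite sumEFin -EFinM /mean (big_nth 0) big_mkord.
Qed.

Lemma ge0_integral_convm (mu nu : {finite_measure set R -> \bar R}) (f : R -> R) :
  measurable_fun [set: R] f -> (forall x, 0 <= f x) ->
  (\int[convm mu nu]_z (f z)%:E)%E = (\int[nu]_y \int[mu]_x (f (x + y))%:E)%E.
Proof.
move=> mf f0; have mEf : measurable_fun [set: R] (EFin \o f) by exact/measurable_EFinP.
rewrite /convm (ge0_integral_pushforward measurable_addR2)//; last first.
  by move=> x _; rewrite lee_fin.
rewrite preimage_setT fubini_tonelli2//.
- by apply: measurableT_comp => //; exact: measurable_addR2.
- by move=> x; rewrite lee_fin.
Qed.

Lemma mean_scale_fset (K : fieldType) (c : R) (B : {fset int}) (f : R -> K) :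
  c != 0 -> mean (scale_fset c B) f = mean B (fun b => f (c * b%:~R)).
Proof.
move=> c0; have inj : injective (fun b : int => c * b%:~R : R).
  by move=> b b' /(mulfI c0)/intr_inj.
rewrite /mean /scale_fset card_imfset//; congr (_ * _).
by rewrite big_imfset//= => b b' _ _; exact: inj.
Qed.

Lemma measurable_mean (T : Type) (s : seq T) (F : T -> R -> R) :
  (forall t, measurable_fun [set: R] (F t)) ->
  measurable_fun [set: R] (fun x => mean s (F^~ x)).
Proof.
move=> mF; apply: measurable_funM => //.
exact: (@measurable_sum _ _ _ _ _ s (fun t => F t)).
Qed.

Lemma bounded_integrable (P : {measure set R -> \bar R}) (f : R -> R) (M : R) :
  P [set: R] = 1%E -> measurable_fun [set: R] f -> (forall x, `|f x| <= M) ->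
  P.-integrable [set: R] (EFin \o f).
Proof.
move=> P1 mf fM; apply: measurable_bounded_integrable => //.
  by rewrite P1 ltry.
exists M; split; first exact: num_real.
by move=> y My x _ /=; exact: le_trans (fM x) (ltW My).
Qed.

Lemma Rintegral_prob_cst (P : {measure set R -> \bar R}) (M : R) :
  P [set: R] = 1%E -> \int[P]_x M = M.
Proof.
move=> P1; rewrite -[X in X = _]/(\int[P]_x cst M x) Rintegral_cst//.
exact: etrans (congr1 (fun u => M * fine u) P1) (mulr1 M).
Qed.

Lemma Rintegral_addc (P : {measure set R -> \bar R}) (f : R -> R) (M : R) :
  P [set: R] = 1%E -> measurable_fun [set: R] f -> (forall x, `|f x| <= M) ->
  \int[P]_x (f x + M) = \int[P]_x f x + M.
Proof.
move=> P1 mf fM; have M0 : 0 <= M by exact: le_trans (fM 0).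
have If := bounded_integrable P1 mf fM.
have IM : P.-integrable [set: R] (EFin \o cst M).
  by apply: (bounded_integrable P1 (M := M)) => // x; rewrite ger0_norm.
by rewrite (RintegralD measurableT If IM) (Rintegral_prob_cst M P1).
Qed.

Section partial.
Context (m : nat) (N : 'I_m -> int) (B : 'I_m -> {fset int}) (omega : nat -> 'I_m).
Hypothesis N2 : forall j, 2 <= `|N j|.
Hypothesis B_gt0 : forall j, (0 < #|` B j|)%N.

(** The index moves by one because [partial_conv] at [n] has [n + 1] factors. The induction is over
    all [f], as Tonelli replaces [f] by its translates. *)
Lemma ge0_integral_partial_conv n (f : R -> R) :
  measurable_fun [set: R] f -> (forall x, 0 <= f x) ->
  (\int[partial_conv (conv_factor N B omega) n]_x (f x)%:E)%E =
  (mean (pts N B omega n.+1) f)%:E.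
Proof.
have sc0 k : (\prod_(i < k) (N (omega i))%:~R)^-1 != 0 :> R.
  by rewrite invr_eq0; exact: (@scale_neq0 R _ N N2 omega k).
elim: n f => [|n IH] f mf f0.
  rewrite mean_pts1 [partial_conv _ _]/= /conv_factor.
  rewrite ge0_integral_unif_delta// mean_scale_fset// big_ord1; congr EFin.
  by apply: eq_mean => b; rewrite mulrC.
rewrite [partial_conv _ _]/= ge0_integral_convm//.
under eq_integral => y _.
  rewrite (IH (fun x => f (x + y)))//; last first.
    by apply: measurableT_comp => //; exact: measurable_funD.
  over.
rewrite ge0_integral_unif_delta//; last 2 first.
- apply: measurable_mean => t; apply: measurableT_comp => //.
  exact: measurable_funD.
- by move=> x; exact: mean_ge0.
rewrite -[in RHS]addn1 mean_pts_split [in RHS]mean_exchange mean_pts1 mean_scale_fset//.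
rewrite /shift addn0; congr EFin; apply: eq_mean => b; apply: eq_mean => x.
by congr f; congr (_ + _); rewrite -/(scale N omega n.+2) scaleSr invfM; ring.
Qed.

Lemma partial_conv_setT n :
  partial_conv (conv_factor N B omega) n [set: R] = 1%E.
Proof.
set P := partial_conv _ _.
transitivity (\int[P]_x (cst (1%:E : \bar R) x))%E.
  by rewrite integral_cst// mul1e.
apply: etrans (ge0_integral_partial_conv n (measurable_cst (1 : R)) _) _.
  by move=> x; exact: ler01.
by rewrite mean_const// size_pts_gt0.
Qed.

(** Adding the bound [M] makes the integrand nonnegative and reduces to the previous formula. *)
Lemma Rintegral_partial_conv n (f : R -> R) :
  measurable_fun [set: R] f -> (exists M, forall x, `|f x| <= M) ->
  \int[partial_conv (conv_factor N B omega) n]_x f x = mean (pts N B omega n.+1) f.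
Proof.
move=> mf [M fM]; have M0 : 0 <= M by exact: le_trans (fM 0).
have fM0 x : 0 <= f x + M by have := fM x; rewrite ler_norml => /andP[]; lra.
have mfM : measurable_fun [set: R] (fun x => f x + M) by exact: measurable_funD.
have := congr1 fine (ge0_integral_partial_conv n mfM fM0).
set P := partial_conv _ _.
rewrite -/(Rintegral P setT (fun x => f x + M)).
rewrite (Rintegral_addc (partial_conv_setT n) mf fM) [fine _]/=.
rewrite meanD mean_const; last exact: (@size_pts_gt0 R _ N B omega n.+1 B_gt0).
exact: addIr.
Qed.

End partial.
End convolution_integrals.

(** * Existence of the infinite convolution *)

Lemma nth_allpairs (S T U : Type) (f : S -> T -> U) (s : seq S) (t : seq T)
    x0 y0 z0 i j : (i < size s)%N -> (j < size t)%N ->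
  nth z0 [seq f x y | x <- s, y <- t] (i * size t + j) = f (nth x0 s i) (nth y0 t j).
Proof.
move=> + jt; elim: s i => [//|a s IH] [|i] si.
  by rewrite allpairs_cons nth_cat size_map mul0n jt (nth_map y0).
rewrite allpairs_cons nth_cat size_map mulSn -addnA ltnNge leq_addr/=.
by rewrite addKn IH.
Qed.

Section step_functions.
Context {R : realType}.
Implicit Types s : seq R.

Definition cell (q i : nat) : set R := `[i%:R / q%:R, i.+1%:R / q%:R[%classic.

(* A step function on [0,1[ whose law under the Lebesgue measure is uniform
   on the list s. *)
Definition step s (u : R) : R :=
  \sum_(i < size s) nth 0 s i * \1_(cell (size s) i) u.

Lemma measurable_step s : measurable_fun [set: R] (step s).
Proof.
apply: measurable_sum => i; apply: measurable_funM => //.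
by apply: measurable_indic; exact: measurable_itv.
Qed.

Lemma cellP q (u : R) i : (0 < q)%N ->
  cell q i u <-> i%:R <= u * q%:R < i.+1%:R.
Proof.
move=> q0; rewrite /cell /= in_itv/= ler_pdivrMr ?ltr0n//.
by rewrite ltr_pdivlMr ?ltr0n.
Qed.

Lemma cell_trunc q (u : R) i : (0 < q)%N -> 0 <= u ->
  cell q i u <-> i = Num.truncn (u * q%:R).
Proof.
move=> q0 u0; rewrite cellP//.
have uq : 0 <= u * q%:R by rewrite mulr_ge0.
have /andP[a b] := truncn_itv uq; split=> [/andP[c d]|->]; last by rewrite a b.
apply/eqP; rewrite eqn_leq; apply/andP; split; rewrite -ltnS -(ltr_nat R).
  exact: le_lt_trans c b.
exact: le_lt_trans a d.
Qed.

Lemma trunc_lt q (u : R) : (0 < q)%N -> 0 <= u < 1 ->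
  (Num.truncn (u * q%:R) < q)%N.
Proof.
move=> q0 /andP[u0 u1]; have uq : 0 <= u * q%:R by rewrite mulr_ge0.
have /andP[a _] := truncn_itv uq; rewrite -(ltr_nat R); apply: (le_lt_trans a).
by rewrite gtr_pMl// ltr0n.
Qed.

Lemma indic_cell q (u : R) i : (0 < q)%N -> 0 <= u ->
  \1_(cell q i) u = (i == Num.truncn (u * q%:R))%:R :> R.
Proof.
move=> q0 u0; rewrite indicE; congr (nat_of_bool _)%:R.
by apply/idP/eqP => [/set_mem /cell_trunc ->//|/cell_trunc H]; apply/mem_set; exact: H.
Qed.

Lemma stepE s (u : R) : (0 < size s)%N -> 0 <= u < 1 ->
  step s u = nth 0 s (Num.truncn (u * (size s)%:R)).
Proof.
move=> s0 u01; have /andP[u0 u1] := u01.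
rewrite /step (bigD1 (Ordinal (trunc_lt s0 u01)))//= indic_cell// eqxx mulr1.
rewrite big1 ?addr0// => i ii; rewrite indic_cell//.
by rewrite (_ : _ == _ = false) ?mulr0//; exact/negbTE.
Qed.

Lemma step_out s (u : R) : ~~ (0 <= u < 1) -> step s u = 0.
Proof.
move=> u01; rewrite /step big1// => i _.
have q0 : (0 < size s)%N by exact: leq_ltn_trans (ltn_ord i).
rewrite indicE memNset ?mulr0// => /cellP -/(_ q0) /andP[a b].
have q1 : 0 < (size s)%:R :> R by rewrite ltr0n.
case/negP: u01; apply/andP; split.
  by rewrite -(pmulr_lge0 _ q1); exact: le_trans a.
rewrite -(ltr_pM2r q1) mul1r; apply: (lt_le_trans b).
by rewrite ler_nat.
Qed.

Lemma ge0_integral_step s (g : R -> R) : (0 < size s)%N ->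
  measurable_fun [set: R] g -> (forall x, 0 <= g x) ->
  (\int[uniform_prob (@ltr01 R)]_u (g (step s u))%:E)%E = (mean s g)%:E.
Proof.
move=> s0 mg g0; set q := size s.
have mgs : measurable_fun [set: R] (fun u => (g (step s u))%:E).
  by apply/measurable_EFinP; apply: measurableT_comp => //; exact: measurable_step.
rewrite integral_uniform//; last by move=> u; rewrite lee_fin.
rewrite subr0 invr1 mul1e -integral_itv_bndo_bndc; last exact: measurable_funTS.
transitivity (\int[lebesgue_measure]_(u in `[0%R, 1%R[%classic)
    \sum_(i <- index_enum 'I_q) ((g (nth 0 s i))%:E * (\1_(cell q i) u)%:E))%E.
  apply: eq_integral => u; rewrite inE/= in_itv/= => u01.
  have /andP[u0 u1] := u01.
  rewrite stepE// (bigD1 (Ordinal (trunc_lt s0 u01)))//= indic_cell// eqxx mule1.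
  rewrite big1 ?adde0// => i ii; rewrite indic_cell//.
  by rewrite (_ : _ == _ = false) ?mule0//; exact/negbTE.
have mI (i : 'I_q) : measurable_fun (`[0%R, 1%R[%classic : set R)
    (fun u : R => (\1_(cell q i) u)%:E).
  apply/measurable_EFinP; apply: measurable_funTS.
  by apply: measurable_indic; exact: measurable_itv.
rewrite ge0_integral_sum//; last 2 first.
- by move=> i; apply: emeasurable_funM => //; exact: mI.
- by move=> i u _; rewrite mule_ge0// lee_fin.
have q1 : 0 < (q%:R : R) by rewrite ltr0n.
rewrite /mean (big_nth 0) big_mkord mulr_sumr -sumEFin; apply: eq_bigr => i _.
rewrite ge0_integralZl_EFin//; last exact: mI.
rewrite integral_indic//; last exact: measurable_itv.
rewrite setIidl; last first.
  move=> u /cellP -/(_ s0) /andP[a b]; rewrite /= in_itv/=; apply/andP; split.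
    by rewrite -(pmulr_lge0 _ q1); exact: le_trans a.
  rewrite -(ltr_pM2r q1) mul1r; apply: (lt_le_trans b).
  by rewrite ler_nat.
rewrite /cell; have := lebesgue_measure_itv `[i%:R / q%:R, i.+1%:R / q%:R[%R => /= ->.
rewrite lte_fin ltr_pM2r ?invr_gt0// ltr_nat ltnSn -EFinB -EFinM; congr EFin.
rewrite -mulrBl -natrB// subSnn mul1r mulrC //.
Qed.

End step_functions.

Section existence.
Context {R : realType} (m : nat) (N : 'I_m -> int) (B : 'I_m -> {fset int}).
Variable omega : nat -> 'I_m.
Hypothesis N2 : forall j, 2 <= `|N j|.
Hypothesis B_gt0 : forall j, (0 < #|` B j|)%N.
Variable C : R.
Hypothesis B_le : forall j b, b \in B j -> `|b%:~R| <= C.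

Let X n : R -> R := step (pts N B omega n).

Let sz n : (0 < size (pts N B omega n : seq R))%N.
Proof. exact: size_pts_gt0. Qed.

(** A coupling on [[0, 1[]: as the atoms are listed lexicographically, the cells at depth [n + k]
    refine those at depth [n], so both values share their first [n] digits and differ by a tail atom
    divided by [scale omega n]. *)
Let X_cauchy n k u : `|X n u - X (n + k)%N u| <= C / 2 ^+ n.
Proof.
have C0 : 0 <= C by exact: (bound_ge0 B_gt0 B_le omega).
have [u01|u01] := boolP (0 <= u < 1); last first.
  by rewrite /X !step_out// subrr normr0 divr_ge0// exprn_ge0.
rewrite /X !stepE//; have /andP[u0 u1] := u01.
set p : seq R := pts N B omega n; pose p' : seq R := pts N B (shift n omega) k.
have p'0 : (0 < size p')%N by exact: size_pts_gt0.
have sE : size (pts N B omega (n + k) : seq R) = (size p * size p')%N.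
  by rewrite pts_split size_allpairs.
set i := Num.truncn (u * (size p)%:R).
set i' := Num.truncn (u * (size (pts N B omega (n + k) : seq R))%:R).
have iE : i = (i' %/ size p')%N.
  apply/esym; apply/(cell_trunc _ (sz n) u0); apply/(cellP _ _ (sz n)).
  have : cell (size (pts N B omega (n + k) : seq R)) i' u by apply/cell_trunc.
  move=> /cellP -/(_ (sz _)) /andP[]; rewrite sE natrM mulrA => a b.
  have q0 : 0 < (size p')%:R :> R by rewrite ltr0n.
  apply/andP; split.
    rewrite -(ler_pM2r q0); apply: le_trans a.
    by rewrite -natrM ler_nat leq_trunc_div.
  rewrite -(ltr_pM2r q0); apply: (lt_le_trans b).
  by rewrite -natrM ler_nat; exact: ltn_ceil.
have ip : (i < size p)%N := trunc_lt (sz n) u01.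
have i'E : i' = (i * size p' + i' %% size p')%N by rewrite iE -divn_eq.
have i'p : (i' %% size p' < size p')%N by rewrite ltn_mod.
rewrite {}i'E pts_split (nth_allpairs _ 0 0 _ ip i'p).
rewrite opprD addrA subrr sub0r normrN normrM normfV.
have yC : `|nth 0 p' (i' %% size p')| <= C.
  by apply: (pts_le N2 B_gt0 B_le (eta := shift n omega) (n := k)); rewrite mem_nth.
rewrite ler_pM ?invr_ge0// lef_pV2 ?posrE ?exprn_gt0//.
  exact: norm_scale_ge.
by rewrite normr_gt0; exact: scale_neq0.
Qed.

Let X_cvg u : cvgn (X ^~ u).
Proof.
apply: cauchy_cvg; apply: cauchy_exP => e e0.
have C0 : 0 <= C by exact: (bound_ge0 B_gt0 B_le omega).
have [n nP] : exists n, C / 2 ^+ n < e.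
  exists (Num.bound (C / e)); have H : 0 <= C / e by rewrite divr_ge0// ltW.
  have /archi_boundP := H; rewrite ltr_pdivrMr// ltr_pdivrMr ?exprn_gt0// => {}H.
  apply: (lt_trans H); rewrite mulrC ltr_pM2l// -natrX ltr_nat.
  exact: ltn_expl.
exists (X n u); exists n => // k /= /subnKC <-.
by rewrite /ball/=; apply: le_lt_trans (X_cauchy n (k - n) u) nP.
Qed.

Let Y u := limn (X ^~ u).

Let mY : measurable_fun [set: R] Y.
Proof.
apply: (@measurable_fun_cvg _ _ _ _ X) => [n|u _]; first exact: measurable_step.
exact: X_cvg.
Qed.

(** The limit is the law of the pointwise limit [Y] of the coupled step functions; weak convergence
    is then dominated convergence on the unit interval. *)
Lemma infinite_convolution_exists :
  exists mu : probability R R, is_infinite_convolution (conv_factor N B omega) mu.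
Proof.
have cX (u : R) : (fun n => X n.+1 u) @ \oo --> Y u.
  by have := @X_cvg u; rewrite -(cvg_shiftS (X ^~ u)).
pose T := measurableTypeR R; pose P := uniform_prob (@ltr01 R).
have mYT : measurable_fun [set: T] (Y : T -> R) by exact: mY.
pose Ym : {mfun T >-> R} := HB.pack (Y : T -> R) (isMeasurableFun.Build _ _ T R Y mYT).
exists (distribution P Ym) => f cf [M fM].
have M0 : 0 <= M by exact: le_trans (fM 0).
pose g x := f x + M.
have cg : continuous g by move=> x; apply: cvgD; [exact: cf|exact: cvg_cst].
have mf : measurable_fun [set: R] f by exact: continuous_measurable_fun.
have mg : measurable_fun [set: R] g by exact: continuous_measurable_fun.
have g0 x : 0 <= g x by have := fM x; rewrite ler_norml /g => /andP[]; lra.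
have gM x : g x <= 2 * M by have := fM x; rewrite ler_norml /g => /andP[]; lra.
have mE (Z : R -> R) : measurable_fun [set: R] Z ->
    measurable_fun [set: T] (fun u : T => (g (Z u))%:E).
  by move=> mZ; apply/measurable_EFinP; exact: measurableT_comp mg mZ.
have [|||||Ig _ Hcvg] := @dominated_convergence _ T _ P [set: T] measurableT
    (fun n u => (g (X n.+1 u))%:E) (fun u => (g (Y u))%:E) (cst (2 * M)%:E).
- by move=> n; apply: mE; exact: measurable_step.
- exact: mE.
- apply: aeW => u _; apply: cvg_EFin; first exact: nearW.
  apply: (@continuous_cvg _ _ _ _ _ (fun n => X n.+1 u) g); first exact: cg.
  exact: cX.
- exact: finite_measure_integrable_cst.
- by apply: aeW => u n _ /=; rewrite lee_fin ger0_norm.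
have Rg : \int[distribution P Ym]_x g x = fine (\int[P]_u (g (Y u))%:E)%E.
  rewrite /Rintegral ge0_integral_distribution//.
  by apply/measurable_EFinP.
have Rf : \int[distribution P Ym]_x f x = fine (\int[P]_u (g (Y u))%:E)%E - M.
  by rewrite -Rg (Rintegral_addc (probability_setT _) mf fM) addrK.
rewrite Rf; under eq_fun => n.
  rewrite (Rintegral_partial_conv omega N2 B_gt0 n mf); last by exists M.
  have -> : mean (pts N B omega n.+1) f = mean (pts N B omega n.+1) g - M.
    by rewrite meanD mean_const ?addrK// sz.
  rewrite -[mean _ g]/(fine (mean (pts N B omega n.+1) g)%:E).
  rewrite -(ge0_integral_step (sz n.+1) mg g0).
  over.
apply: cvgB; last exact: cvg_cst.
apply: fine_cvg; rewrite fineK//; exact: integrable_fin_num.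
Qed.

End existence.

(** * Density of Lipschitz functions *)

Section lipschitz_density.
Context {R : realType}.
Variable mu : probability R R.

Definition bounded_lipschitz (g : R -> R) := [/\ continuous g,
  exists M, forall x, `|g x| <= M & exists K, forall x y, `|g x - g y| <= K * `|x - y|].

Lemma lipschitz_continuous (g : R -> R) (K : R) :
  (forall x y, `|g x - g y| <= K * `|x - y|) -> continuous g.
Proof.
move=> gK x; have K1 : 0 < `|K| + 1 by rewrite ltr_wpDl.
apply/cvgrPdist_lt => e e0; near=> y.
apply: (le_lt_trans (gK x y)).
apply: (@le_lt_trans _ _ ((`|K| + 1) * `|x - y|)).
  rewrite ler_wpM2r//; have := ler_norm K; lra.
rewrite mulrC -ltr_pdivlMr//; near: y.
by apply: cvgr_dist_lt => //; rewrite divr_gt0.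
Unshelve. all: by end_near. Qed.

Lemma bounded_lipschitzD g h : bounded_lipschitz g -> bounded_lipschitz h ->
  bounded_lipschitz (fun x => g x + h x).
Proof.
move=> [cg [M gM] [K gK]] [ch [M' hM] [K' hK]]; split.
- by move=> x; apply: cvgD; [exact: cg|exact: ch].
- by exists (M + M') => x; apply: (le_trans (ler_normD _ _)); exact: lerD.
- exists (K + K') => x y; rewrite opprD addrACA.
  by apply: (le_trans (ler_normD _ _)); rewrite mulrDl; exact: lerD.
Qed.

Lemma bounded_lipschitzZ g c : bounded_lipschitz g ->
  bounded_lipschitz (fun x => c * g x).
Proof.
move=> [cg [M gM] [K gK]]; split.
- by move=> x; apply: cvgM; [exact: cvg_cst|exact: cg].
- by exists (`|c| * M) => x; rewrite normrM ler_wpM2l.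
- by exists (`|c| * K) => x y; rewrite -mulrBr normrM -mulrA ler_wpM2l.
Qed.

Lemma bounded_lipschitz_cst c : bounded_lipschitz (fun=> c).
Proof.
split; first by move=> x; exact: cvg_cst.
  by exists `|c|.
by exists 0 => x y; rewrite subrr normr0 mul0r.
Qed.

Lemma bounded_lipschitz_measurable g : bounded_lipschitz g ->
  measurable_fun [set: R] g.
Proof. by case=> cg _ _; exact: continuous_measurable_fun. Qed.

Definition sqint (h : R -> R) : \bar R := (\int[mu]_x ((h x) ^+ 2)%:E)%E.

Let msqr (h : R -> R) : measurable_fun [set: R] h ->
  measurable_fun [set: R] (fun x => ((h x) ^+ 2)%:E).
Proof. by move=> mh; apply/measurable_EFinP; exact: measurable_funX. Qed.

Lemma sqintD h1 h2 (a b : R) : measurable_fun [set: R] h1 ->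
  measurable_fun [set: R] h2 -> (sqint h1 < a%:E)%E -> (sqint h2 < b%:E)%E ->
  (sqint (fun x => h1 x + h2 x)%R < (2 * a + 2 * b)%R%:E)%E.
Proof.
move=> m1 m2 h1a h2b.
apply: (@le_lt_trans _ _ ((2%R : R)%:E * sqint h1 + (2%R : R)%:E * sqint h2)%E); last first.
  by rewrite (EFinD (2 * a)) !EFinM; apply: lteD; rewrite lte_pmul2l.
have s0 (h : R -> R) x : [set: R] x -> (0 <= ((h x) ^+ 2)%:E)%E.
  by move=> _; rewrite lee_fin sqr_ge0.
rewrite /sqint -!ge0_integralZl_EFin//; try exact: msqr; try exact: s0.
rewrite -ge0_integralD//; last 4 first.
- by move=> x _; rewrite -EFinM lee_fin mulr_ge0// sqr_ge0.
- by apply: emeasurable_funM => //; exact: msqr.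
- by move=> x _; rewrite -EFinM lee_fin mulr_ge0// sqr_ge0.
- by apply: emeasurable_funM => //; exact: msqr.
apply: ge0_le_integral => //.
- by move=> x _; rewrite lee_fin sqr_ge0.
- by apply: msqr; exact: measurable_funD.
- by apply: emeasurable_funD; apply: emeasurable_funM => //; exact: msqr.
- move=> x _; rewrite -!EFinM -EFinD lee_fin.
  have := sqr_ge0 (h1 x - h2 x); nra.
Qed.

Lemma sqint_dominated (h : nat -> R -> R) (G : R -> R) :
  (forall n, measurable_fun [set: R] (h n)) ->
  (forall x, h^~ x @ \oo --> (0 : R)) -> mu.-integrable [set: R] (EFin \o G) ->
  (forall n x, (h n x) ^+ 2 <= G x) ->
  forall e : R, 0 < e -> exists n, (sqint (h n) < e%:E)%E.
Proof.
move=> mh h0 IG hG e e0.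
have [||||| _ _] := @dominated_convergence _ _ _ mu [set: R] measurableT
  (fun n x => ((h n x) ^+ 2)%:E) (cst 0%E) (EFin \o G).
- by move=> n; exact: msqr.
- exact: measurable_cst.
- apply: aeW => x _; apply: cvg_EFin; first exact: nearW.
  have : (fun n => h n x * h n x) @ \oo --> (0 * 0 : R) by apply: cvgM; exact: h0.
  by rewrite mulr0.
- exact: IG.
- by apply: aeW => x n _ /=; rewrite lee_fin ger0_norm ?sqr_ge0.
rewrite integral0 => /(_ [set y | (y < e%:E)%E]) [|n _ H].
  by apply: open_nbhs_nbhs; split; [exact: open_ereal_lt_ereal|rewrite /= lte_fin].
by exists n; exact: (H n (leqnn n)).
Qed.

Definition lipschitz_approx (f : R -> R) := forall e : R, 0 < e ->
  exists2 g, bounded_lipschitz g & (sqint (fun x => f x - g x)%R < e%:E)%E.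

Lemma lipschitz_approxD (f h : R -> R) : measurable_fun [set: R] f -> measurable_fun [set: R] h ->
  lipschitz_approx f -> lipschitz_approx h -> lipschitz_approx (fun x => f x + h x).
Proof.
move=> mf mh af ah e e0; have e4 : 0 < e / 4 by lra.
have [g lg fg] := af _ e4; have [k lk hk] := ah _ e4.
exists (fun x => g x + k x); first exact: bounded_lipschitzD.
have mg := bounded_lipschitz_measurable lg.
have mk := bounded_lipschitz_measurable lk.
have := sqintD (measurable_funB mf mg) (measurable_funB mh mk) fg hk.
have -> : 2 * (e / 4) + 2 * (e / 4) = e by lra.
apply: le_lt_trans; rewrite le_eqVlt; apply/orP; left; apply/eqP.
by apply: eq_integral => x _; congr (_ ^+ 2)%:E => /=; ring.
Qed.

Lemma lipschitz_approxZ (f : R -> R) (c : R) : measurable_fun [set: R] f ->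
  lipschitz_approx f -> lipschitz_approx (fun x => c * f x).
Proof.
(* [c ^+ 2 + 1] in place of [c ^+ 2] also covers [c = 0]. *)
move=> mf af e e0; have c1 : 0 < c ^+ 2 + 1 by rewrite ltr_wpDl// sqr_ge0.
have [g lg fg] := af _ (divr_gt0 e0 c1).
exists (fun x => c * g x); first exact: bounded_lipschitzZ.
have mg := bounded_lipschitz_measurable lg.
apply: (@le_lt_trans _ _ ((c ^+ 2 + 1)%:E * sqint (fun x => f x - g x)%R)%E); last first.
  by rewrite -lte_pdivlMl// -EFinM mulrC.
rewrite /sqint -ge0_integralZl_EFin//; last 3 first.
- by move=> x _; rewrite lee_fin sqr_ge0.
- by apply: msqr; exact: measurable_funB.
- exact: ltW.
apply: ge0_le_integral => //.
- by move=> x _; rewrite lee_fin sqr_ge0.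
- by apply: msqr; apply: measurable_funB; apply: measurable_funM.
- by apply: emeasurable_funM => //; apply: msqr; exact: measurable_funB.
- move=> x _; rewrite -EFinM lee_fin -mulrBr exprMn ler_wpM2r ?sqr_ge0//.
  by rewrite lerDl.
Qed.

Lemma lipschitz_approx_limit (f : R -> R) : measurable_fun [set: R] f ->
  (forall e : R, 0 < e -> exists2 h, measurable_fun [set: R] h /\ lipschitz_approx h &
     (sqint (fun x => f x - h x)%R < e%:E)%E) ->
  lipschitz_approx f.
Proof.
move=> mf H e e0; have e4 : 0 < e / 4 by lra.
have [h [mh ah] fh] := H _ e4; have [g lg hg] := ah _ e4.
exists g => //; have mg := bounded_lipschitz_measurable lg.
have := sqintD (measurable_funB mf mh) (measurable_funB mh mg) fh hg.
have -> : 2 * (e / 4) + 2 * (e / 4) = e by lra.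
apply: le_lt_trans; rewrite le_eqVlt; apply/orP; left; apply/eqP.
by apply: eq_integral => x _; congr (_ ^+ 2)%:E => /=; ring.
Qed.

Let integrable_cst (c : R) : mu.-integrable [set: R] (EFin \o cst c).
Proof. exact: finite_measure_integrable_cst. Qed.

(** The ramps of slope [n] starting at [a] converge pointwise to the indicator of the open ray and
    stay in [[0, 1]]. *)
Lemma lipschitz_approx_ray (a : R) : lipschitz_approx \1_(`]a, +oo[%classic).
Proof.
pose ramp (n : nat) x : R := Num.min 1 (Num.max 0 (n%:R * (x - a))).
have ramp01 n x : 0 <= ramp n x <= 1.
  by rewrite /ramp ge_min lexx le_min ler01 le_max lexx.
have ramp_lip n x y : `|ramp n x - ramp n y| <= n%:R * `|x - y|.
  have -> : n%:R * `|x - y| = `|n%:R * (x - a) - n%:R * (y - a)|.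
    by rewrite -mulrBr normrM ger0_norm//; congr (_ * `|_|); ring.
  rewrite /ramp; move: (n%:R * (x - a)) (n%:R * (y - a)) => u v.
  have := normr_ge0 (u - v); have := ler_norm (u - v).
  have := ler_norm (v - u); rewrite (distrC v).
  move=> A1 A2 A3; rewrite ler_norml.
  by case: (leP 0 u) => ?; case: (leP 0 v) => ?; rewrite ?(min_r (@ler01 R));
    case: (leP 1 u) => ?; case: (leP 1 v) => ?; apply/andP; split; lra.
have lip n : bounded_lipschitz (ramp n).
  split; first exact: lipschitz_continuous (ramp_lip n).
    by exists 1 => x; have /andP[r0 r1] := ramp01 n x; rewrite ger0_norm.
  by exists n%:R.
have m1 : measurable_fun [set: R] (\1_(`]a, +oo[%classic) : R -> R).
  by apply: measurable_indic; exact: measurable_itv.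
move=> e e0.
have [||n nP] := @sqint_dominated (fun n x => \1_(`]a, +oo[%classic) x - ramp n x)
  (cst 1) (fun n => measurable_funB m1 (bounded_lipschitz_measurable (lip n)))
  _ (integrable_cst 1) _ e e0.
- move=> x; have [xa|ax] := leP x a.
    apply: cvg_near_cst; apply: nearW => n.
    rewrite indicE memNset ?sub0r; last by rewrite /= in_itv/= andbT ltNge xa.
    rewrite /ramp max_l ?min_r ?oppr0//.
    by rewrite mulr_ge0_le0// subr_le0.
  apply: cvg_near_cst; exists (Num.bound (x - a)^-1) => // n /= nb.
  rewrite indicE mem_set; last by rewrite /= in_itv/= andbT.
  have : 1 <= n%:R * (x - a).
    rewrite -ler_pdivrMr ?subr_gt0// mul1r.
    have : 0 <= (x - a)^-1 by rewrite invr_ge0 subr_ge0 ltW.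
    by move=> /archi_boundP/ltW/le_trans; apply; rewrite ler_nat.
  by move=> H; rewrite /ramp max_r ?min_l ?subrr//; lra.
- move=> n x /=; have /andP[r0 r1] := ramp01 n x.
  by rewrite indicE; case: (_ \in _) => /=; nra.
by exists (ramp n).
Qed.

(** Dynkin's theorem: open rays are stable under intersection and generate the Borel sets, and the
    approximable sets are closed under complements and countable disjoint unions. *)
Lemma lipschitz_approx_indic (A : set R) : measurable A -> lipschitz_approx \1_A.
Proof.
move=> mA; move: (mA).
have E : @measurable _ R = <<s @RGenOInfty.G R >> := RGenOInfty.measurableE R.
rewrite E; apply: (@dynkin_induction _ _ (@RGenOInfty.G R)
  (fun A => lipschitz_approx \1_A) E).
- move=> _ _ [a ->] [b ->]; exists (Num.max a b).
  apply/seteqP; split=> x /=; rewrite !in_itv/= !andbT gt_max.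
    by move=> [-> ->].
  by move=> /andP[].
- move=> e e0; exists (cst 1); first exact: bounded_lipschitz_cst.
  rewrite /sqint integral0_eq ?lte_fin// => x _.
  by rewrite indicT subrr expr0n.
- by move=> _ [a ->]; exact: lipschitz_approx_ray.
- move=> S mS aS e e0; have [g lg Sg] := aS e e0.
  exists (fun x => 1 + (-1) * g x).
    apply: bounded_lipschitzD; first exact: bounded_lipschitz_cst.
    exact: bounded_lipschitzZ.
  move: Sg; apply: le_lt_trans; rewrite le_eqVlt; apply/orP; left; apply/eqP.
  apply: eq_integral => x _; rewrite !indicE in_setC.
  by congr EFin; case: (x \in S) => /=; ring.
- move=> F mF tF aF.
  have mU : measurable (\bigcup_k F k) by exact: bigcup_measurable.
  apply: lipschitz_approx_limit; first exact: measurable_indic.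
  (* By disjointness these sums are indicators of the partial unions, so the differences are
     dominated by 1. *)
  pose S n x : R := \sum_(k < n) \1_(F k) x.
  have mS n : measurable_fun [set: R] (S n).
    by apply: measurable_sum => k; exact: measurable_indic.
  have aS n : lipschitz_approx (S n).
    elim: n => [|n IH].
      move=> e e0; exists (cst 0); first exact: bounded_lipschitz_cst.
      rewrite /sqint integral0_eq ?lte_fin// => x _.
      by rewrite /S big_ord0 subrr expr0n.
    have -> : S n.+1 = fun x => S n x + \1_(F n) x.
      by apply/funext => x; rewrite /S big_ord_recr.
    by apply: lipschitz_approxD => //; exact: measurable_indic.
  have S_in n x k : F k x -> S n x = (k < n)%N%:R.
    move=> Fk; rewrite /S; have [kn|nk] := ltnP k n.
      rewrite (bigD1 (Ordinal kn))//= indicE mem_set// big1 ?addr0// => i ik.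
      rewrite indicE memNset// => Fi; case/eqP: ik; apply: val_inj => /=.
      by apply: (tF i k I I); exists x.
    rewrite big1// => i _; rewrite indicE memNset// => Fi.
    have ik : (i : nat) = k by apply: (tF i k I I); exists x.
    by have := ltn_ord i; rewrite ik ltnNge nk.
  have S_out n x : ~ (\bigcup_k F k) x -> S n x = 0.
    move=> H; rewrite /S big1// => i _; rewrite indicE memNset// => Fi.
    by apply: H; exists i.
  move=> e e0.
  have [||n nP] := @sqint_dominated (fun n x => \1_(\bigcup_k F k) x - S n x)
    (cst 1) (fun n => measurable_funB (measurable_indic mU) (mS n))
    _ (integrable_cst 1) _ e e0; last by exists (S n).
  + move=> x; have [[k _ Fk]|nF] := pselect ((\bigcup_k F k) x).
      apply: cvg_near_cst; exists k.+1 => // n /= kn.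
      by rewrite indicE mem_set ?(S_in _ _ _ Fk) ?kn ?subrr//; exists k.
    by apply: cvg_near_cst; apply: nearW => n; rewrite indicE memNset// S_out// subrr.
  + move=> n x /=; have [[k _ Fk]|nF] := pselect ((\bigcup_k F k) x).
      rewrite indicE mem_set ?(S_in _ _ _ Fk); last by exists k.
      by case: (k < n)%N => /=; rewrite ?subrr ?subr0 ?expr0n ?expr1n.
    by rewrite indicE memNset// S_out// subrr expr0n.
Qed.

Import HBNNSimple.

Lemma lipschitz_approx_ge0 (f : R -> R) : measurable_fun [set: R] f ->
  (forall x, 0 <= f x) -> (sqint f < +oo)%E -> lipschitz_approx f.
Proof.
move=> mf f0 If.
have mEf : measurable_fun [set: R] (EFin \o f) by exact/measurable_EFinP.
have Ef0 x : [set: R] x -> (0 <= (EFin \o f) x)%E by move=> _; rewrite lee_fin.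
pose h := nnsfun_approx measurableT mEf.
have ah n : lipschitz_approx (h n).
  have -> : (h n : R -> R) = fun x =>
      \sum_(y <- fset_set (range (h n))) y * \1_(h n @^-1` [set y]) x.
    by apply/funext => x; rewrite fimfunE fsbig_finite.
  elim: (enum_fset (fset_set (range (h n)))) => [|y s IH].
    move=> e e0; exists (cst 0); first exact: bounded_lipschitz_cst.
    rewrite /sqint integral0_eq ?lte_fin// => x _.
    by rewrite big_nil subrr expr0n.
  have mI z : measurable (h n @^-1` [set z]) by exact: measurable_sfunP.
  have -> : (fun x => \sum_(j <- y :: s) j * \1_(h n @^-1` [set j]) x) =
      (fun x => y * \1_(h n @^-1` [set y]) x +
                \sum_(j <- s) j * \1_(h n @^-1` [set j]) x).
    by apply/funext => x; rewrite big_cons.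
  apply: lipschitz_approxD => //.
  - by apply: measurable_funM => //; exact: measurable_indic.
  - by apply: measurable_sum => z; apply: measurable_funM => //; exact: measurable_indic.
  - apply: lipschitz_approxZ; first exact: measurable_indic.
    exact: lipschitz_approx_indic.
have h_le n x : h n x <= f x.
  by rewrite -lee_fin nnsfun_approxE; exact: le_approx.
apply: lipschitz_approx_limit => // e e0.
have [|||n nP] := @sqint_dominated (fun n x => f x - h n x) (fun x => (f x) ^+ 2)
  (fun n => measurable_funB mf (measurable_funPT (h n))) _ _ _ e e0.
- move=> x; rewrite -[X in _ --> X](subrr (f x)).
  apply: cvgB; first exact: cvg_cst.
  have := cvg_nnsfun_approx measurableT mEf Ef0 (I : [set: R] x).
  by move=> /fine_cvg.
- apply/integrableP; split; first exact: msqr.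
  under eq_integral do rewrite /= ger0_norm ?sqr_ge0//.
  exact: If.
- move=> n x; rewrite ler_sqr ?nnegrE ?subr_ge0// gerBl.
  exact: fun_ge0.
by exists (h n) => //; split.
Qed.

Lemma lipschitz_dense (f : R -> R) : measurable_fun [set: R] f ->
  (sqint f < +oo)%E -> lipschitz_approx f.
Proof.
move=> mf If.
have part (g : R -> R) : measurable_fun [set: R] g -> (forall x, g x ^+ 2 <= f x ^+ 2) ->
    (sqint g < +oo)%E.
  move=> mg gf; apply: le_lt_trans If; apply: ge0_le_integral => //.
  - by move=> x _; rewrite lee_fin sqr_ge0.
  - exact: msqr.
  - exact: msqr.
  - by move=> x _; rewrite lee_fin.
have mp : measurable_fun [set: R] (fun x => Num.max (f x) 0).
  exact: measurable_maxr.
have mn : measurable_fun [set: R] (fun x => Num.max (- f x) 0).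
  by apply: measurable_maxr => //; exact: measurable_funN.
have -> : f = fun x => Num.max (f x) 0 + (-1) * Num.max (- f x) 0.
  by apply/funext => x; case: (leP (f x) 0); case: (leP (- f x) 0); lra.
apply: lipschitz_approxD => //; first exact: measurable_funM.
  apply: lipschitz_approx_ge0 => //; first by move=> x; rewrite le_max lexx orbT.
  by apply: part => // x; case: (leP (f x) 0) => H; rewrite ?expr0n ?sqr_ge0.
apply: lipschitz_approxZ => //.
apply: lipschitz_approx_ge0 => //; first by move=> x; rewrite le_max lexx orbT.
by apply: part => // x; case: (leP (- f x) 0) => H; rewrite ?expr0n ?sqr_ge0 ?sqrrN.
Qed.

End lipschitz_density.

(** * Fourier coefficients for the limit measure *)

Section complex_functions.
Context {R : realType}.
Implicit Types f g : R -> R[i].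

Definition bounded_continuous f := [/\ continuous (fun x => complex.Re (f x)),
  continuous (fun x => complex.Im (f x)) & exists M, forall x, sqn (f x) <= M].

Lemma bounded_continuousM f g : bounded_continuous f -> bounded_continuous g ->
  bounded_continuous (fun x => f x * g x).
Proof.
move=> [rf jf [M fM]] [rg jg [M' gM]]; split.
- move=> x; under eq_fun do rewrite ReM.
  by apply: cvgB; apply: cvgM; [exact: rf|exact: rg|exact: jf|exact: jg].
- move=> x; under eq_fun do rewrite ImM.
  by apply: cvgD; apply: cvgM; [exact: rf|exact: jg|exact: jf|exact: rg].
- by exists (M * M') => x; rewrite sqnM ler_pM ?sqn_ge0.
Qed.

Lemma bounded_continuousD f g : bounded_continuous f -> bounded_continuous g ->
  bounded_continuous (fun x => f x + g x).
Proof.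
move=> [rf jf [M fM]] [rg jg [M' gM]]; split.
- move=> x; under eq_fun do rewrite ReD.
  by apply: cvgD; [exact: rf|exact: rg].
- move=> x; under eq_fun do rewrite ImD.
  by apply: cvgD; [exact: jf|exact: jg].
- exists (2 * M + 2 * M') => x; apply: (le_trans (sqnD_le2 _ _)).
  by apply: lerD; rewrite ler_pM2l.
Qed.

Lemma bounded_continuousN f : bounded_continuous f -> bounded_continuous (fun x => - f x).
Proof.
move=> [rf jf [M fM]]; split.
- by move=> x; under eq_fun do rewrite ReN; apply: cvgN; exact: rf.
- by move=> x; under eq_fun do rewrite ImN; apply: cvgN; exact: jf.
- by exists M => x; rewrite /sqn ReN ImN !sqrrN; exact: fM.
Qed.

Lemma bounded_continuous_cst (z : R[i]) : bounded_continuous (fun=> z).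
Proof.
by split; [move=> x; exact: cvg_cst|move=> x; exact: cvg_cst|exists (sqn z)].
Qed.

Lemma bounded_continuous_e1 (a : R) : bounded_continuous (fun x => e1 (a * x)).
Proof.
have lin : continuous (fun x : R => 2 * pi * (a * x)).
  move=> x; apply: cvgM; first exact: cvg_cst.
  by apply: cvgM; [exact: cvg_cst|exact: cvg_id].
split.
- by move=> x; exact: (continuous_comp (lin x) (@continuous_cos R _)).
- by move=> x; exact: (continuous_comp (lin x) (@continuous_sin R _)).
- by exists 1 => x; rewrite sqn_e1.
Qed.

Lemma bounded_continuous_sum (I : Type) (s : seq I) (F : I -> R -> R[i]) :
  (forall i, bounded_continuous (F i)) ->
  bounded_continuous (fun x => \sum_(i <- s) F i x).
Proof.
move=> bF; elim: s => [|i s IH].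
  by under eq_fun do rewrite big_nil; exact: bounded_continuous_cst.
by under eq_fun do rewrite big_cons; exact: bounded_continuousD.
Qed.

Let sqr_le_bound (a M : R) : a ^+ 2 <= M -> `|a| <= M + 1.
Proof. by move=> aM; rewrite ler_norml; apply/andP; split; nra. Qed.

Lemma bounded_continuous_Re f : bounded_continuous f ->
  continuous (fun x => complex.Re (f x)) /\
  exists M, forall x, `|complex.Re (f x)| <= M.
Proof.
move=> [rf _ [M fM]]; split=> //; exists (M + 1) => x; apply: sqr_le_bound.
by apply: le_trans (fM x); rewrite lerDl sqr_ge0.
Qed.

Lemma bounded_continuous_Im f : bounded_continuous f ->
  continuous (fun x => complex.Im (f x)) /\
  exists M, forall x, `|complex.Im (f x)| <= M.
Proof.
move=> [_ jf [M fM]]; split=> //; exists (M + 1) => x; apply: sqr_le_bound.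
by apply: le_trans (fM x); rewrite lerDr sqr_ge0.
Qed.

Lemma bounded_continuous_sqn f : bounded_continuous f ->
  continuous (fun x => sqn (f x)) /\ exists M, forall x, `|sqn (f x)| <= M.
Proof.
move=> [rf jf [M fM]]; split; last by exists M => x; rewrite ger0_norm ?sqn_ge0.
by move=> x; apply: cvgD; apply: cvgM; [exact: rf|exact: rf|exact: jf|exact: jf].
Qed.

End complex_functions.

Section limit_measure.
Context {R : realType} (m : nat) (N : 'I_m -> int) (B : 'I_m -> {fset int}).
Variable omega : nat -> 'I_m.
Hypothesis N2 : forall j, 2 <= `|N j|.
Hypothesis B_gt0 : forall j, (0 < #|` B j|)%N.
Variable mu : probability R R.
Hypothesis mu_lim : is_infinite_convolution (conv_factor N B omega) mu.
Implicit Types f : R -> R[i].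

Local Notation P n := (@pts R 'I_m N B omega n).

Lemma mean_cvg (f : R -> R) : continuous f /\ (exists M, forall x, `|f x| <= M) ->
  (fun n => mean (P n) f) @ \oo --> \int[mu]_x f x.
Proof.
move=> [cf bf]; have := mu_lim cf bf.
under eq_fun do rewrite (Rintegral_partial_conv omega N2 B_gt0 _
  (continuous_measurable_fun cf) bf).
by rewrite (cvg_shiftS (fun n => mean (P n) f)).
Qed.

Definition fourier_coef f (l : int) : R[i] :=
  L2_dot mu f (fun x => e1 (l%:~R * x)).

Let bc_coef f (l : int) : bounded_continuous f ->
  bounded_continuous (fun x => f x * e1 (- (x * l%:~R))).
Proof.
move=> bf; apply: bounded_continuousM => //.
under eq_fun do rewrite mulrC -mulNr.
exact: bounded_continuous_e1.
Qed.

Lemma coef_Re_cvg f l : bounded_continuous f ->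
  (fun n => complex.Re (coef N B omega n f l%:~R)) @ \oo -->
  complex.Re (fourier_coef f l).
Proof.
move=> bf; under eq_fun do rewrite Re_mean.
have -> : complex.Re (fourier_coef f l) =
    \int[mu]_x complex.Re (f x * e1 (- (x * l%:~R))).
  by apply: eq_Rintegral => x _; rewrite -conj_e1 [x * _]mulrC.
by apply: mean_cvg; exact: bounded_continuous_Re (bc_coef _ bf).
Qed.

Lemma coef_Im_cvg f l : bounded_continuous f ->
  (fun n => complex.Im (coef N B omega n f l%:~R)) @ \oo -->
  complex.Im (fourier_coef f l).
Proof.
move=> bf; under eq_fun do rewrite Im_mean.
have -> : complex.Im (fourier_coef f l) =
    \int[mu]_x complex.Im (f x * e1 (- (x * l%:~R))).
  by apply: eq_Rintegral => x _; rewrite -conj_e1 [x * _]mulrC.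
by apply: mean_cvg; exact: bounded_continuous_Im (bc_coef _ bf).
Qed.

Definition combination (s : seq int) (a : int -> R[i]) (x : R) : R[i] :=
  \sum_(l <- s) a l * e1 (l%:~R * x).

Lemma bounded_continuous_combination s a : bounded_continuous (combination s a).
Proof.
apply: bounded_continuous_sum => l; apply: bounded_continuousM.
  exact: bounded_continuous_cst.
exact: bounded_continuous_e1.
Qed.

Variables (n0 : nat) (s : seq int).
Hypothesis s_uniq : uniq s.
Hypothesis s_orth : forall l l', l \in s -> l' \in s -> l != l' ->
  ft N B omega n0 (l'%:~R - l%:~R : R) = 0.

Lemma ft_orth n l l' : (n0 <= n)%N -> l \in s -> l' \in s ->
  ft N B omega n (l'%:~R - l%:~R : R) = (l == l')%:R.
Proof.
move=> /subnKC <- ls l's; have [->|ll'] := eqVneq l l'; first by rewrite subrr ft0.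
by rewrite ft_split s_orth// mul0r.
Qed.

(** The coefficients [a] are arbitrary, because those of [mu], not those at depth [n], will be
    inserted; hence the cross term survives. *)
Lemma mean_sqn_sub_combination n f a : (n0 <= n)%N ->
  mean (P n) (fun t => sqn (f t - combination s a t)) =
  mean (P n) (fun t => sqn (f t)) -
  2 * (\sum_(l <- s) complex.Re (conjc (a l) * coef N B omega n f l%:~R)) +
  \sum_(l <- s) sqn (a l).
Proof.
move=> n0n; pose w := combination s a.
have sqnB (u v : R[i]) : sqn (u - v) = sqn u - 2 * complex.Re (u * conjc v) + sqn v.
  by rewrite /sqn !reimE; ring.
under eq_mean do rewrite sqnB.
rewrite meanD meanD meanN meanZ; congr (_ - 2 * _ + _).
  rewrite -Re_mean -Re_sum; congr complex.Re.
  under eq_bigr do rewrite -meanZ.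
  rewrite -mean_sum; apply: eq_mean => t.
  rewrite /combination conjc_sum mulr_sumr; apply: eq_bigr => l _.
  by rewrite conjcM conj_e1 [l%:~R * t]mulrC mulrCA.
apply: complexI; rewrite -mean_real_complex rmorph_sum /=.
transitivity (\sum_(l <- s) \sum_(l' <- s) a l * conjc (a l') *
    ft N B omega n (l%:~R - l'%:~R)).
  under eq_mean do rewrite sqnC /combination conjc_sum mulr_suml.
  rewrite mean_sum; apply: eq_bigr => l _.
  under eq_mean do rewrite mulr_sumr.
  rewrite mean_sum; apply: eq_bigr => l' _.
  rewrite -meanZ; apply: eq_mean => t.
  by rewrite conjcM conj_e1 mulrACA -e1D; congr (_ * e1 _); ring.
rewrite !big_seq; apply: eq_bigr => l ls.
transitivity (\sum_(l' <- s | l' == l) a l * conjc (a l')).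
  rewrite [RHS]big_mkcond !big_seq; apply: eq_bigr => l' l's.
  by rewrite ft_orth//; case: eqP => _; rewrite ?mulr1 ?mulr0.
by rewrite -big_filter filter_pred1_uniq// big_seq1 sqnC.
Qed.

(** Limit of the discrete identity: the coefficients at depth [n] tend to [a], so the cross term
    tends to twice the sum of the [sqn (a l)]. *)
Lemma integral_sqn_sub_projection f : bounded_continuous f ->
  \int[mu]_x sqn (f x - combination s (fourier_coef f) x) =
  \int[mu]_x sqn (f x) - \sum_(l <- s) sqn (fourier_coef f l).
Proof.
move=> bf; set a := fourier_coef f.
have bw : bounded_continuous (fun x => f x - combination s a x).
  apply: bounded_continuousD => //; apply: bounded_continuousN.
  exact: bounded_continuous_combination.
have H1 := mean_cvg (bounded_continuous_sqn bw).
have H2 : (fun n => mean (P n) (fun t => sqn (f t)) -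
    2 * (\sum_(l <- s) complex.Re (conjc (a l) * coef N B omega n f l%:~R)) +
    \sum_(l <- s) sqn (a l)) @ \oo -->
    \int[mu]_x sqn (f x) - 2 * (\sum_(l <- s) sqn (a l)) + \sum_(l <- s) sqn (a l).
  apply: cvgD; last exact: cvg_cst.
  apply: cvgB; first exact: mean_cvg (bounded_continuous_sqn bf).
  apply: cvgM; first exact: cvg_cst.
  elim: s => [|l r IH].
    by under eq_fun do rewrite big_nil; rewrite big_nil; exact: cvg_cst.
  under eq_fun do rewrite big_cons; rewrite big_cons; apply: cvgD => //.
  have -> : sqn (a l) = complex.Re (conjc (a l)) * complex.Re (a l) -
      complex.Im (conjc (a l)) * complex.Im (a l).
    by rewrite Reconj Imconj /sqn; ring.
  under eq_fun do rewrite ReM.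
  apply: cvgB; (apply: cvgM; first exact: cvg_cst).
    exact: coef_Re_cvg.
  exact: coef_Im_cvg.
have H3 : (fun n => mean (P n) (fun t => sqn (f t - combination s a t))) @ \oo -->
    \int[mu]_x sqn (f x) - 2 * (\sum_(l <- s) sqn (a l)) + \sum_(l <- s) sqn (a l).
  apply: cvg_trans H2; apply: near_eq_cvg; exists n0 => // n /= n0n.
  by rewrite mean_sqn_sub_combination.
rewrite (cvg_unique _ H1 H3) => //; by ring.
Qed.

End limit_measure.

(** * Spectrality *)

Section square_norm.
Context {R : realType}.
Variable mu : probability R R.
Implicit Types f g : R -> R[i].

Definition complex_measurable f :=
  measurable_fun [set: R] (fun x => complex.Re (f x)) /\
  measurable_fun [set: R] (fun x => complex.Im (f x)).

Definition norm2 f : \bar R := (\int[mu]_x (sqn (f x))%:E)%E.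

Lemma measurable_sqn f : complex_measurable f ->
  measurable_fun [set: R] (fun x => (sqn (f x))%:E).
Proof.
move=> [mr mi]; apply/measurable_EFinP.
by apply: measurable_funD; exact: measurable_funX.
Qed.

Lemma complex_measurableD f g : complex_measurable f -> complex_measurable g ->
  complex_measurable (fun x => f x + g x).
Proof.
move=> [fr fi] [gr gi]; split.
  by under eq_fun do rewrite ReD; exact: measurable_funD.
by under eq_fun do rewrite ImD; exact: measurable_funD.
Qed.

Lemma complex_measurableN f : complex_measurable f ->
  complex_measurable (fun x => - f x).
Proof.
move=> [fr fi]; split.
  by under eq_fun do rewrite ReN; exact: measurable_funN.
by under eq_fun do rewrite ImN; exact: measurable_funN.
Qed.

Lemma bounded_continuous_measurable f : bounded_continuous f -> complex_measurable f.
Proof. by move=> [cr ci _]; split; exact: continuous_measurable_fun. Qed.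

Lemma norm2_Rintegral f : bounded_continuous f ->
  norm2 f = (\int[mu]_x sqn (f x))%:E.
Proof.
move=> /bounded_continuous_sqn[cf [M fM]].
rewrite /norm2 /Rintegral fineK//; apply: integrable_fin_num => //.
apply: bounded_integrable fM; first exact: probability_setT.
exact: continuous_measurable_fun.
Qed.

Lemma norm2D f g (t a b : R) : 0 < t -> complex_measurable f -> complex_measurable g ->
  (norm2 f <= a%:E)%E -> (norm2 g <= b%:E)%E ->
  (norm2 (fun x => f x + g x)%R <= ((1 + t) * a + (1 + t^-1) * b)%R%:E)%E.
Proof.
move=> t0 mf mg fa gb.
have t1 : 0 <= 1 + t by lra.
have t1' : 0 <= 1 + t^-1 by rewrite addr_ge0// invr_ge0 ltW.
apply: (@le_trans _ _ ((1 + t)%R%:E * norm2 f + (1 + t^-1)%R%:E * norm2 g)%E); last first.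
  by rewrite (EFinD ((1 + t) * a)) !EFinM; apply: leeD; rewrite lee_wpmul2l// lee_fin.
have s0 h x : [set: R] x -> (0 <= (sqn (h x : R[i]))%:E)%E.
  by move=> _; rewrite lee_fin sqn_ge0.
have ms := measurable_sqn.
rewrite /norm2 -!ge0_integralZl_EFin//; try exact: ms; try exact: s0.
rewrite -ge0_integralD//; last 4 first.
- by move=> x _; rewrite -EFinM lee_fin mulr_ge0// sqn_ge0.
- by apply: emeasurable_funM => //; exact: ms.
- by move=> x _; rewrite -EFinM lee_fin mulr_ge0// sqn_ge0.
- by apply: emeasurable_funM => //; exact: ms.
apply: ge0_le_integral => //.
- exact: s0.
- by apply: ms; exact: complex_measurableD.
- by apply: emeasurable_funD; apply: emeasurable_funM => //; exact: ms.
- by move=> x _; rewrite -!EFinM -EFinD lee_fin; exact: sqnD_le.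
Qed.

Lemma complex_lipschitz_dense f : complex_measurable f -> (norm2 f < +oo)%E ->
  forall e : R, 0 < e -> exists2 g,
    bounded_lipschitz (fun x => complex.Re (g x)) /\
    bounded_lipschitz (fun x => complex.Im (g x)) &
    (norm2 (fun x => f x - g x)%R <= e%:E)%E.
Proof.
move=> mf fi e e0; have [mr mi] := mf; have e2 : 0 < e / 2 by lra.
have part (h : R -> R) : measurable_fun [set: R] h -> (forall x, h x ^+ 2 <= sqn (f x)) ->
    (sqint mu h < +oo)%E.
  move=> mh hf; apply: le_lt_trans fi; apply: ge0_le_integral => //.
  - by move=> x _; rewrite lee_fin sqr_ge0.
  - by apply/measurable_EFinP; exact: measurable_funX.
  - exact: measurable_sqn.
  - by move=> x _; rewrite lee_fin.
have Ir : (sqint mu (fun x => complex.Re (f x)) < +oo)%E.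
  by apply: part => // x; rewrite /sqn lerDl sqr_ge0.
have Ii : (sqint mu (fun x => complex.Im (f x)) < +oo)%E.
  by apply: part => // x; rewrite /sqn lerDr sqr_ge0.
have [g1 l1 g1P] := lipschitz_dense mr Ir e2.
have [g2 l2 g2P] := lipschitz_dense mi Ii e2.
exists (fun x => Complex (g1 x) (g2 x)) => //.
have -> : norm2 (fun x => f x - Complex (g1 x) (g2 x)) =
    (sqint mu (fun x => complex.Re (f x) - g1 x)%R +
     sqint mu (fun x => complex.Im (f x) - g2 x)%R)%E.
  rewrite -ge0_integralD//.
  - by apply: eq_integral => x _; rewrite -EFinD /sqn !reimE.
  - by move=> x _; rewrite lee_fin sqr_ge0.
  - apply/measurable_EFinP; apply: measurable_funX; apply: measurable_funB => //.
    exact: bounded_lipschitz_measurable.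
  - by move=> x _; rewrite lee_fin sqr_ge0.
  - apply/measurable_EFinP; apply: measurable_funX; apply: measurable_funB => //.
    exact: bounded_lipschitz_measurable.
have -> : e = e / 2 + e / 2 by lra.
by rewrite EFinD leeD// ltW.
Qed.

End square_norm.

Section spectrality.
Context {R : realType} (m : nat) (N : 'I_m -> int) (B : 'I_m -> {fset int}).
Variable omega : nat -> 'I_m.
Hypothesis N2 : forall j, 2 <= `|N j|.
Hypothesis B_gt0 : forall j, (0 < #|` B j|)%N.
Variable C : R.
Hypothesis B_le : forall j b, b \in B j -> `|b%:~R| <= C.
Variable mu : probability R R.
Hypothesis mu_lim : is_infinite_convolution (conv_factor N B omega) mu.
Variables (c0 : R) (n : nat -> nat) (s : nat -> seq int).
Hypothesis c0_gt0 : 0 < c0.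
Hypothesis n_ge : forall i, (i <= n i)%N.
Hypothesis s_spectrum : forall i, @discrete_spectrum R 'I_m N B omega (n i) (s i).
Hypothesis s_tail : forall i, tail_positive N B c0 omega (n i) (s i).
Hypothesis s_sub : forall i, {subset s i <= s i.+1}.

Let c := Num.min c0 (1 / 4).

Let c_gt0 : 0 < c. Proof. by rewrite lt_min c0_gt0 divr_gt0. Qed.

Let c_le : c <= 1 / 4. Proof. by rewrite ge_min lexx orbT. Qed.

(** The squared residual is [I - S], and [coef_tail] in the limit gives
    [S >= (c / 2) (I - e) - e / 2]; the error terms amount to at most [e]. *)
Lemma projection_estimate (f : R -> R[i]) (e : R) :
  bounded_lipschitz (fun x => complex.Re (f x)) ->
  bounded_lipschitz (fun x => complex.Im (f x)) -> 0 < e ->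
  exists i (a : int -> R[i]), \int[mu]_x sqn (f x - combination (s i) a x) <=
    (1 - c / 2) * (\int[mu]_x sqn (f x)) + e.
Proof.
move=> [cr [M rM] [K rK]] [ci [M' iM] [K' iK]] e0.
have bf : bounded_continuous f.
  split => //; exists (M ^+ 2 + M' ^+ 2) => x; apply: lerD.
    by rewrite -real_normK ?num_real// lerXn2r ?nnegrE// (le_trans _ (rM x)).
  by rewrite -real_normK ?num_real// lerXn2r ?nnegrE// (le_trans _ (iM x)).
have C0 : 0 <= C := bound_ge0 B_gt0 B_le omega.
pose K2 := K ^+ 2 + K' ^+ 2.
have K20 : 0 <= K2 by rewrite addr_ge0 ?sqr_ge0.
have fL x y : sqn (f x - f y) <= K2 * `|x - y| ^+ 2.
  rewrite /sqn !reimE /K2 mulrDl -!exprMn; apply: lerD.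
    rewrite -real_normK ?num_real//.
    by rewrite lerXn2r ?nnegrE// (le_trans _ (rK x y)).
  rewrite -real_normK ?num_real//.
  by rewrite lerXn2r ?nnegrE// (le_trans _ (iK x y)).
(* The Lipschitz bound gives [D / |scale| ^+ 2], weakened below to [D / 2 ^+ i]. *)
pose D := K2 * C ^+ 2.
have D0 : 0 <= D by rewrite mulr_ge0 ?sqr_ge0.
have fe i x y : `|y| <= C -> sqn (f x - f (x + y / scale N omega (n i))) <= D / 2 ^+ i.
  move=> yC; apply: (le_trans (fL _ _)).
  rewrite opprD addrA subrr sub0r normrN normrM normfV exprMn /D -[leRHS]mulrA.
  rewrite ler_wpM2l// ler_pM ?sqr_ge0//; first by rewrite lerXn2r ?nnegrE.
  have P1 : 2 ^+ i <= `|scale N omega (n i)| :> R.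
    apply: le_trans (norm_scale_ge N2 omega (n i)).
    by rewrite ler_eXn2l// ltr1n.
  have P0 : 0 < (2 ^+ i : R) by rewrite exprn_gt0.
  have P2 : 1 <= (2 ^+ i : R) by rewrite exprn_ege1// ler1n.
  rewrite exprVn lef_pV2 ?posrE ?exprn_gt0//; last exact: lt_le_trans P1.
  by apply: (le_trans P1); rewrite ler_eXnr// (le_trans P2).
set I := \int[mu]_x sqn (f x).
have [i [iI iD]] : exists i, I - e <= mean (pts N B omega (n i)) (fun t => sqn (f t)) /\
    D / 2 ^+ i <= e / 2.
  have := mean_cvg N2 B_gt0 mu_lim (bounded_continuous_sqn bf).
  move=> /cvgrPdist_le/(_ _ e0)[k _ kP].
  have H0 : 0 <= 2 * D / e by rewrite divr_ge0 ?mulr_ge0// ltW.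
  pose i := maxn k (Num.bound (2 * D / e)).
  exists i; split.
    have := kP (n i) (leq_trans (leq_maxl _ _) (n_ge i)).
    by rewrite -/I => /(le_trans (ler_norm _)); lra.
  have := archi_boundP H0; rewrite ltr_pdivrMr// => H.
  rewrite ler_pdivrMr ?exprn_gt0//.
  have : (Num.bound (2 * D / e))%:R <= 2 ^+ i :> R.
    rewrite -natrX ler_nat; apply: (leq_trans (leq_maxr k _)).
    by apply: ltnW; exact: ltn_expl.
  move: H; move: (Num.bound _)%:R (2 ^+ i : R) => u v H uv.
  have : u * e <= v * e by rewrite ler_wpM2r// ltW.
  lra.
have [us orth pars] := s_spectrum i.
exists i, (fourier_coef mu f); rewrite (integral_sqn_sub_projection N2 B_gt0 mu_lim us orth bf).
rewrite -/I; set S := \sum_(l <- s i) _.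
(* The depth [n i] on the left is fixed, while the depth of the coefficients goes to infinity. *)
have low : c * mean (pts N B omega (n i)) (fun t => sqn (f t)) <= 2 * S + 2 * (D / 2 ^+ i).
  have cv : (fun k => 2 * (\sum_(l <- s i) sqn (coef N B omega k f l%:~R)) +
      2 * (D / 2 ^+ i)) @ \oo --> 2 * S + 2 * (D / 2 ^+ i).
    apply: cvgD; last exact: cvg_cst.
    apply: cvgM; first exact: cvg_cst.
    rewrite /S; elim: (s i) => [|l r IH].
      by under eq_fun do rewrite big_nil; rewrite big_nil; exact: cvg_cst.
    under eq_fun do rewrite big_cons; rewrite big_cons; apply: cvgD => //.
    have cR := coef_Re_cvg N2 B_gt0 mu_lim (l := l) bf.
    have cI := coef_Im_cvg N2 B_gt0 mu_lim (l := l) bf.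
    by apply: cvgD; apply: cvgM.
  apply: (ler_cvg_to (cvg_cst _) cv); exists (n i) => // k /= /subnKC <-.
  exact: (coef_tail N2 B_gt0 B_le _ (s_spectrum i) (@s_tail i) (fe i)).
have := ler_wpM2l (ltW c_gt0) iI; have := c_le; have := c_gt0.
have : 0 <= D / 2 ^+ i by rewrite divr_ge0// exprn_ge0.
nra.
Qed.

Lemma combination_extend i j (a : int -> R[i]) : (i <= j)%N ->
  combination (s i) a = combination (s j) (fun l => if l \in s i then a l else 0).
Proof.
move=> ij; have sub : {subset s i <= s j}.
  move: ij => /subnKC <-; elim: (j - i)%N => [|k IH]; first by rewrite addn0.
  by move=> l /IH; rewrite addnS; exact: s_sub.
have [ui _ _] := s_spectrum i; have [uj _ _] := s_spectrum j.
apply/funext => x; rewrite /combination.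
transitivity (\sum_(l <- s j | l \in s i) a l * e1 (l%:~R * x)); last first.
  by rewrite big_mkcond; apply: eq_bigr => l _; case: ifP; rewrite ?mul0r.
rewrite -[RHS]big_filter; apply: perm_big; apply: uniq_perm => //.
  exact: filter_uniq.
move=> l; rewrite mem_filter; case: (boolP (l \in s i)) => //= /sub ->.
by [].
Qed.

Lemma combinationD i j (a b : int -> R[i]) : exists k d,
  forall x, combination (s i) a x + combination (s j) b x = combination (s k) d x.
Proof.
exists (maxn i j), (fun l => (if l \in s i then a l else 0) + (if l \in s j then b l else 0)).
move=> x; rewrite (combination_extend a (leq_maxl i j)) (combination_extend b (leq_maxr i j)).
by rewrite /combination -big_split; apply: eq_bigr => l _; rewrite mulrDl.
Qed.

Let measurable_combination i a : complex_measurable (combination (s i) a : R -> R[i]).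
Proof. exact/bounded_continuous_measurable/bounded_continuous_combination. Qed.

(** [f] is replaced by a Lipschitz [g], [g] is projected, and the result is compared with [f] again:
    two weighted triangle inequalities. *)
Lemma contraction_step (f : R -> R[i]) (a d : R) : complex_measurable f ->
  (norm2 mu f <= a%:E)%E -> 0 < d ->
  exists i b, (norm2 mu (fun x => f x - combination (s i) b x)%R <=
               ((1 - c / 4) * a + d)%R%:E)%E.
Proof.
(* With this [t], [(1 + t) ^+ 2 * (1 - c / 2) <= 1 - c / 4]: the two inequalities consume only half
   of the gain. *)
move=> mf fa d0; pose t := c / 8; have t0 : 0 < t by rewrite /t divr_gt0.
have ti0 : 0 < t^-1 by rewrite invr_gt0.
have a0 : 0 <= a.
  by rewrite -lee_fin; apply: le_trans fa; apply: integral_ge0 => x _; rewrite lee_fin sqn_ge0.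
(* Total coefficient of the approximation error, which is therefore taken to be [d / D]. *)
pose D := (1 + t) * ((1 - c / 2) * (1 + t^-1)) + (1 + t) + (1 + t^-1).
have c2 : 0 <= 1 - c / 2 by have := c_le; lra.
have D0 : 0 < D.
  have : 0 <= (1 + t) * ((1 - c / 2) * (1 + t^-1)).
    by apply: mulr_ge0; [lra|apply: mulr_ge0 => //; lra].
  by rewrite /D; lra.
have h0 : 0 < d / D by rewrite divr_gt0.
have fi : (norm2 mu f < +oo)%E by apply: (le_lt_trans fa); exact: ltry.
have [g [lr li] fg] := complex_lipschitz_dense mf fi h0.
have bg : bounded_continuous g.
  have [cr [M rM] _] := lr; have [ci [M' iM] _] := li.
  split => //; exists (M ^+ 2 + M' ^+ 2) => x; apply: lerD.
    by rewrite -real_normK ?num_real// lerXn2r ?nnegrE// (le_trans _ (rM x)).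
  by rewrite -real_normK ?num_real// lerXn2r ?nnegrE// (le_trans _ (iM x)).
have mg := bounded_continuous_measurable bg.
have [i [b ib]] := projection_estimate lr li h0.
exists i, b; pose w := combination (s i) b.
have mfg := complex_measurableD mf (complex_measurableN mg).
have mgw := complex_measurableD mg (complex_measurableN (measurable_combination i b)).
have gf : (norm2 mu (fun x => g x - f x)%R <= (d / D)%:E)%E.
  apply: le_trans fg; rewrite le_eqVlt; apply/orP; left; apply/eqP.
  by apply: eq_integral => x _; congr EFin; rewrite /sqn !reimE; ring.
have g_le : (norm2 mu g <= ((1 + t) * a + (1 + t^-1) * (d / D))%R%:E)%E.
  have := norm2D t0 mf (complex_measurableD mg (complex_measurableN mf)) fa gf.
  apply: le_trans; rewrite le_eqVlt; apply/orP; left; apply/eqP.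
  by apply: eq_integral => x _; congr (sqn _)%:E; rewrite addrC subrK.
have bgw : bounded_continuous (fun x => g x - w x).
  apply: bounded_continuousD => //; apply: bounded_continuousN.
  exact: bounded_continuous_combination.
rewrite norm2_Rintegral// lee_fin in g_le.
have gw : (norm2 mu (fun x => g x - w x)%R <=
    ((1 - c / 2) * ((1 + t) * a + (1 + t^-1) * (d / D)) + d / D)%R%:E)%E.
  rewrite norm2_Rintegral// lee_fin; apply: (le_trans ib).
  by rewrite lerD2r ler_wpM2l.
have := norm2D t0 mgw mfg gw fg.
have -> : norm2 mu (fun x => (g x - w x) + (f x - g x)) = norm2 mu (fun x => f x - w x).
  by apply: eq_integral => x _; congr (sqn _)%:E; ring.
move/le_trans; apply; rewrite lee_fin.
have -> : (1 + t) * ((1 - c / 2) * ((1 + t) * a + (1 + t^-1) * (d / D)) + d / D) +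
    (1 + t^-1) * (d / D) = (1 + t) ^+ 2 * (1 - c / 2) * a + D * (d / D).
  by rewrite /D; ring.
rewrite [D * _]mulrC divfK ?gt_eqF// lerD2r ler_wpM2r// /t.
have := c_gt0; have := c_le; nra.
Qed.

Lemma combinations_dense (f : R -> R[i]) (e : R) : complex_measurable f ->
  (norm2 mu f < +oo)%E -> 0 < e ->
  exists i a, (norm2 mu (fun x => f x - combination (s i) a x)%R < e%:E)%E.
Proof.
move=> mf fi e0.
have f0 : (0 <= norm2 mu f)%E by apply: integral_ge0 => x _; rewrite lee_fin sqn_ge0.
have fE : norm2 mu f = (fine (norm2 mu f))%:E by rewrite fineK// ge0_fin_numE.
set A := fine _ in fE.
have A0 : 0 <= A by rewrite -lee_fin -fE.
(* Makes [e / 2] the fixed point of [v |-> (1 - c / 4) v + d], so the additive errors never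
   accumulate beyond it. *)
pose d := e / 2 * (c / 4).
have d0 : 0 < d by rewrite !mulr_gt0// ?invr_gt0.
pose q := 1 - c / 4.
have iter k : exists i a, (norm2 mu (fun x => f x - combination (s i) a x)%R <=
    (q ^+ k * A + e / 2)%R%:E)%E.
  elim: k => [|k [i [a IH]]].
    exists 0%N, (fun=> 0); rewrite expr0 mul1r.
    have -> : norm2 mu (fun x => f x - combination (s 0) (fun=> 0) x) = A%:E.
      rewrite -fE; apply: eq_integral => x _; congr (sqn _)%:E.
      by rewrite /combination big1 ?subr0// => l _; rewrite mul0r.
    by rewrite lee_fin lerDl divr_ge0// ltW.
  have mfa := complex_measurableD mf (complex_measurableN (measurable_combination i a)).
  have [j [b jb]] := contraction_step mfa IH d0.
  have [k' [a' ab]] := combinationD i j a b.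
  exists k', a'; move: jb.
  have -> : norm2 mu (fun x => f x - combination (s i) a x - combination (s j) b x) =
      norm2 mu (fun x => f x - combination (s k') a' x).
    by apply: eq_integral => x _; congr (sqn _)%:E; rewrite -ab opprD addrA.
  move/le_trans; apply; rewrite lee_fin /d -/q exprS.
  by rewrite le_eqVlt; apply/orP; left; apply/eqP; rewrite /q; field.
have q1 : `|q| < 1.
  by rewrite /q ltr_norml; have := c_gt0; have := c_le; lra.
have /cvgrPdist_lt/(_ (e / 2 / (A + 1))) [|k _ kP] := cvg_expr q1.
  by rewrite !divr_gt0// ltr_wpDl.
have [i [a ia]] := iter k; exists i, a; apply: (le_lt_trans ia).
have := kP k (leqnn k); rewrite /= sub0r normrN => /(le_lt_trans (ler_norm _)).
rewrite ltr_pdivlMr ?ltr_wpDl// lte_fin => H.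
have q0 : 0 <= q ^+ k by rewrite exprn_ge0// /q; have := c_le; lra.
lra.
Qed.

Lemma limit_spectral : spectral_measure mu.
Proof.
have e1E (l : int) : (fun x : R => expi (2 * pi * l%:~R * x)) = fun x => e1 (l%:~R * x).
  by apply/funext => x; rewrite /e1 mulrA.
have s_le i j : (i <= j)%N -> {subset s i <= s j}.
  move=> /subnKC <-; elim: (j - i)%N => [|k IH]; first by rewrite addn0.
  by move=> l /IH; rewrite addnS; exact: s_sub.
exists [set x | exists i l, l \in s i /\ x = l%:~R :> R]; split.
  apply: (@sub_countable _ _ _ ((fun l : int => l%:~R : R) @` [set: int])).
    by apply: subset_card_le => _ [i [l [_ ->]]]; exists l.
  apply: (sub_countable (card_image_le _ _)); exact: countableP.
split.
- move=> _ [i [l [_ ->]]]; rewrite e1E; have be := bounded_continuous_e1 (l%:~R : R).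
  have [mr mi] := bounded_continuous_measurable be.
  split => //; under eq_integral do rewrite sqn_normc.
  by rewrite -/(norm2 mu _) norm2_Rintegral// ltry.
- move=> _ _ [i [l [ls ->]]] [j [l' [l's ->]]]; rewrite !e1E.
  have be := bounded_continuous_e1 (l%:~R : R).
  have [k [lk l'k]] : exists k, l \in s k /\ l' \in s k.
    exists (maxn i j); split; first exact: s_le (leq_maxl i j) _ ls.
    exact: s_le (leq_maxr i j) _ l's.
  have [us orth _] := s_spectrum k.
  (* By orthogonality the discrete coefficients are constant from depth [n k] on, so their limits
     are the inner products in L^2(mu). *)
  have coefE : \forall p \near \oo,
      coef N B omega p (fun x : R => e1 (l%:~R * x)) l'%:~R = (l == l')%:R.
    exists (n k) => // p /= kp; rewrite eq_sym.
    apply: etrans (ft_orth B_gt0 orth kp l'k lk).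
    by apply: eq_mean => t; rewrite -e1D; congr e1; ring.
  rewrite eqr_int; apply: complex_ext.
    apply: (cvg_unique _ (coef_Re_cvg N2 B_gt0 mu_lim (l := l') be)) => //.
    apply: cvg_near_cst; apply: filterS coefE => p -> //.
  apply: (cvg_unique _ (coef_Im_cvg N2 B_gt0 mu_lim (l := l') be)) => //.
  by apply: cvg_near_cst; apply: filterS coefE => p ->.
- move=> f [mr mi fi] e e0.
  have fi' : (norm2 mu f < +oo)%E.
    by move: fi; under eq_integral do rewrite sqn_normc.
  have [i [a ia]] := combinations_dense (conj mr mi) fi' (exprn_gt0 2 e0).
  have [us _ _] := s_spectrum i.
  (* The basis is indexed by reals; [Num.floor] recovers the integer frequency. *)
  exists (seq_fset tt [seq l%:~R | l <- s i]), (fun x => a (Num.floor x)); split.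
    move=> x xs; have /mapP[l ls ->] : x \in [seq l%:~R | l <- s i].
      by rewrite -(seq_fsetE tt).
    by exists i, l.
  move: ia; congr (_ < _)%E; apply: eq_integral => x _; rewrite sqn_normc.
  congr (sqn (_ - _))%:E; rewrite (perm_big _ (seq_fset_perm _ _)).
  rewrite undup_id ?map_inj_uniq//; last exact: intr_inj.
  rewrite big_map; apply: eq_bigr => l _.
  by rewrite /e1 mulrA; congr (a _ * _); rewrite intrKfloor.
Qed.

End spectrality.

Lemma hadamard_limit_spectral (R : realType) (m : nat)
    (N : 'I_m -> int) (B L : 'I_m -> {fset int})
    (BL_hadamard : forall j : 'I_m, hadamard_triple R (N j) (B j) (L j))
    (gcd_B : forall j : 'I_m, gcd_fset (diff_set (B j)) = 1)
    (omega : nat -> 'I_m) (mu : probability R R) :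
  is_infinite_convolution (conv_factor N B omega) mu -> spectral_measure mu.
Proof.
move=> mu_lim.
have N2 j : 2 <= `|N j| := triple_N2 (BL_hadamard j).
have B_gt0 j : (0 < #|` B j|)%N := triple_B_gt0 (BL_hadamard j).
have [C C0 B_le] := @digits_bounded R m B.
have [c0 c00 equi] := equipositive BL_hadamard gcd_B.
pose l0 j := nth 0 (L j) 0.
have l0L j : l0 j \in L j by apply: mem_nth; exact: triple_L_gt0 (BL_hadamard j).
pose Ls j := [seq l - l0 j | l <- L j].
have Ls0 j : 0 \in Ls j by apply/mapP; exists (l0 j); rewrite ?subrr.
have Ls_uniq j : uniq (Ls j) by rewrite map_inj_uniq ?fset_uniq//; exact: addIr.
have Ls_orth j l l' : l \in Ls j -> l' \in Ls j -> l != l' ->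
    mask (B j) ((l'%:~R - l%:~R) / (N j)%:~R : R) = 0.
  move=> /mapP[k kL ->] /mapP[k' k'L ->] kk'.
  have -> : (k' - l0 j)%:~R - (k - l0 j)%:~R = k'%:~R - k%:~R :> R.
    by rewrite !intrB; ring.
  apply: (triple_mask_orth (BL_hadamard j)) => //.
  by apply: contraNneq kk' => ->.
have Ls_parseval j (h : int -> R[i]) :
    \sum_(l <- Ls j) sqn (mean (B j) (fun b =>
      h b * e1 (- (b%:~R * l%:~R / (N j)%:~R)))) = mean (B j) (fun b => sqn (h b)).
  rewrite big_map.
  (* Translating the frequencies by [l0] is a modulation of [h], which leaves [sqn (h b)]
     unchanged. *)
  pose h' b := h b * e1 (b%:~R * (l0 j)%:~R / (N j)%:~R).
  transitivity (mean (B j) (fun b => sqn (h' b))); last first.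
    by apply: eq_mean => b; rewrite /h' sqnM sqn_e1 mulr1.
  rewrite -(hadamard_parseval (BL_hadamard j)); apply: eq_bigr => l _.
  congr sqn; apply: eq_mean => b; rewrite /h' -[RHS]mulrA -e1D intrB.
  by congr (_ * e1 _); ring.
have [n [s H]] := spectrum_sequence N2 B_gt0 Ls0 Ls_uniq Ls_orth Ls_parseval
  C0 B_le equi omega.
apply: (limit_spectral N2 B_gt0 B_le mu_lim c00 (n := n) (s := s)) => i;
  by have [] := H i.
Qed.

Theorem corollary1p2 (R : realType) (m : nat) (m_ge1 : (1 <= m)%N)
    (N : 'I_m -> int) (B L : 'I_m -> {fset int})
    (BL_hadamard : forall j : 'I_m, hadamard_triple R (N j) (B j) (L j))
    (gcd_B : forall j : 'I_m, gcd_fset (diff_set (B j)) = 1)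
    (omega : nat -> 'I_m) :
  (exists mu : probability R R,
     is_infinite_convolution (conv_factor N B omega) mu) /\
  (forall mu : probability R R,
     is_infinite_convolution (conv_factor N B omega) mu ->
     spectral_measure mu).
Proof.
split; last by move=> mu; exact: hadamard_limit_spectral BL_hadamard gcd_B omega mu.
have [C _ B_le] := @digits_bounded R m B.
apply: (infinite_convolution_exists omega _ _ B_le) => j.
- exact: triple_N2 (BL_hadamard j).
- exact: triple_B_gt0 (BL_hadamard j).
Qed.
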